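(* If $V$ is a tractable real normed vector space, then the magnitude $\mathrm{mag}\colon\mathrm{Cmp}_+(V)\to\mathbb{R}$ is continuous at $\{x\}$ for every $x\in V$.
   Context: For a finite metric space $F=\{a_1,\dots,a_n\}$ (distinct points) with metric $d$, its similarity matrix is $Z_F\in\mathbb{R}^{n\times n}$ with $(Z_F)_{ij}=e^{-d(a_i,a_j)}$. A metric space is positive definite if every finite subspace has a positive definite similarity matrix. For a finite positive definite space $F$, its magnitude $\mathrm{mag}(F)$ is the sum of all entries of $Z_F^{-1}$ (so $\mathrm{mag}(\emptyset)=0$). For a compact positive definite space $K$, $\mathrm{mag}(K):=\sup\{\mathrm{mag}(F) : F\subseteq K \text{ finite}\}\in[0,\infty]$; this agrees with the previous definition when $K$ is finite. A metric space $M$ is tractable if it is positive definite and, for every $x\in M$ and real $r>0$, the closed ball in $M$ with center $x$ and radius $r$ is compact and has finite magnitude (hence every compact subset of $M$ has finite magnitude). A normed space is regarded as a metric space via its norm. $\mathrm{Cmp}_+(V)$ is the set of non-empty compact subsets of $V$, equipped with the Hausdorff metric. *)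

(* Defs.v *)
From HB Require Import structures.
From mathcomp Require Import all_boot all_order all_algebra.
From mathcomp Require Import finmap.
From mathcomp Require Import all_classical all_reals all_analysis.

Set Implicit Arguments.
Unset Strict Implicit.
Unset Printing Implicit Defensive.

Import Order.TTheory GRing.Theory Num.Theory.
Import numFieldNormedType.Exports.

Local Open Scope classical_set_scope.
Local Open Scope ring_scope.

Section Magnitude.
Context {R : realType}.

Definition posdefmx n (A : 'M[R]_n) : Prop :=
  A^T = A /\ forall v : 'cV[R]_n, v != 0 -> 0 < (v^T *m A *m v) 0 0.

Context {M : metricType R}.
Implicit Types (F : {fset M}) (K : set M).

(* The points a_1, ..., a_n of F, in the enumeration order chosen by finmap;
   F is duplicate-free, so they are distinct. *)
Definition fset_point F (i : 'I_#|` F|) : M := tnth (in_tuple (enum_fset F)) i.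

Definition similarity_mx F : 'M[R]_#|` F| :=
  \matrix_(i, j) expR (- mdist (fset_point i) (fset_point j)).

Definition fset_mag F : R := \sum_i \sum_j invmx (similarity_mx F) i j.

Definition mag K : \bar R :=
  ereal_sup [set (fset_mag F)%:E | F in [set F : {fset M} | [set` F] `<=` K]].

(* The library's [closed_ball] is the closure of the open ball, which may be
   smaller than this set in a general metric space. *)
Definition mclosed_ball (x : M) (r : R) : set M := [set y | mdist x y <= r].

End Magnitude.

Definition positive_definite {R : realType} (M : metricType R) : Prop :=
  forall F : {fset M}, posdefmx (similarity_mx F).

Definition tractable {R : realType} (M : metricType R) : Prop :=
  positive_definite M /\
  forall (x : M) (r : R), 0 < r ->
    compact (mclosed_ball x r) /\ (mag (mclosed_ball x r) < +oo)%E.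

(* [normedModType] does not inherit from [metricType]: this alias carries the
   metric of the norm, on top of the pseudometric structure of [V]. *)
Definition norm_metric {R : realType} (V : normedModType R) : Type := V.

Section NormMetric.
Context {R : realType} (V : normedModType R).

HB.instance Definition _ := PseudoMetric.copy (norm_metric V) V.

Let dist (x y : norm_metric V) : R := `|(x : V) - y|.

Let dist_ge0 x y : 0 <= dist x y. Proof. exact: normr_ge0. Qed.

Let dist_positivity x y : dist x y = 0 -> x = y.
Proof. by move/normr0_eq0/eqP; rewrite subr_eq0 => /eqP. Qed.

Let ballEdist (x : norm_metric V) (d : R) : ball x d = [set y | dist x y < d].
Proof. by rewrite -[LHS]/(@ball R V x d) -ball_normE. Qed.

HB.instance Definition _ := @PseudoMetric_isMetric.Build R (norm_metric V)
  dist dist_ge0 dist_positivity ballEdist.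

End NormMetric.

Record cmp_plus {R : realType} (M : metricType R) := CmpPlus {
  cmp_set :> set M ;
  cmp_compact : compact cmp_set ;
  cmp_neq0 : cmp_set !=set0 }.

Section HausdorffMetric.
Context {R : realType} {M : metricType R}.
Implicit Types (x y : M) (A B C : cmp_plus M).

HB.instance Definition _ := gen_eqMixin (cmp_plus M).
HB.instance Definition _ := gen_choiceMixin (cmp_plus M).

Definition set_dist x (B : set M) : R := inf [set mdist x y | y in B].

Definition set_excess (A B : set M) : R := sup [set set_dist x B | x in A].

Definition hausdorff_dist A B : R :=
  Num.max (set_excess A B) (set_excess B A).

Lemma cmp_plus_eq A B : cmp_set A = cmp_set B -> A = B.
Proof.
case: A B => [A cA A0] [B cB B0] /= AB; subst B.
by rewrite (Prop_irrelevance cA cB) (Prop_irrelevance A0 B0).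
Qed.

Lemma set_dist_le x y B : cmp_set B y -> set_dist x B <= mdist x y.
Proof.
move=> By; apply: ge_inf; last by exists y.
by exists 0 => _ [z _ <-]; exact: mdist_ge0.
Qed.

Lemma le_set_dist x B (e : R) :
  (forall y, cmp_set B y -> e <= mdist x y) -> e <= set_dist x B.
Proof.
move=> Be; apply: lb_le_inf; last by move=> _ [y By <-]; exact: Be.
by have [y By] := cmp_neq0 B; exists (mdist x y); exists y.
Qed.

Lemma set_dist_lt x B (e : R) :
  set_dist x B < e -> exists2 y, cmp_set B y & mdist x y < e.
Proof.
move=> xBe; apply: contrapT => Be; move: xBe; apply/negP; rewrite -leNgt.
apply: le_set_dist => y By; rewrite leNgt; apply/negP => xye.
by apply: Be; exists y.
Qed.

Lemma compact_mbounded (x : M) (K : set M) :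
  compact K -> exists r : R, 0 < r /\ K `<=` mclosed_ball x r.
Proof.
move=> /compact_near_coveringP Kco.
have /Kco : forall y, K y -> \forall z \near y & r \near +oo, mdist x z <= r.
  move=> y Ky; exists (ball y 1, [set r | mdist x y + 1 <= r]).
    split; first exact: nbhsx_ballx.
    by apply: nbhs_pinfty_ge; exact: num_real.
  move=> [z r] /= []; rewrite ballEmdist /= => yz; apply: le_trans.
  by apply: (le_trans (metric_triangle _ y _)); rewrite lerD2l ltW.
move=> Kr; near (pinfty_nbhs R) => r; exists r; split; first by [].
by near: r; exact: Kr.
Unshelve. all: by end_near.
Qed.

Lemma set_dist_excess x A B : cmp_set A x -> set_dist x B <= set_excess A B.
Proof.
move=> Ax; apply: ub_le_sup; last by exists x.
have [y By] := cmp_neq0 B; have [r [_ Ar]] := compact_mbounded y (@cmp_compact _ _ A).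
exists r => _ [z Az <-]; apply: le_trans (set_dist_le z By) _.
by rewrite metric_sym; exact: Ar.
Qed.

Lemma set_excess_le A B (e : R) :
  (forall x, cmp_set A x -> set_dist x B <= e) -> set_excess A B <= e.
Proof.
move=> Ae; apply: ge_sup; last by move=> _ [x Ax <-]; exact: Ae.
by have [x Ax] := cmp_neq0 A; exists (set_dist x B); exists x.
Qed.

Lemma set_dist_ge0 x B : 0 <= set_dist x B.
Proof. by apply: le_set_dist => y _; exact: mdist_ge0. Qed.

Lemma set_excessxx A : set_excess A A = 0.
Proof.
apply/eqP; rewrite eq_le; apply/andP; split.
  by apply: set_excess_le => x Ax; rewrite -(mdistxx x); exact: set_dist_le.
have [x Ax] := cmp_neq0 A.
by apply: le_trans (set_dist_excess A Ax); exact: set_dist_ge0.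
Qed.

Lemma set_excess_le0 A B : set_excess A B <= 0 -> cmp_set A `<=` cmp_set B.
Proof.
move=> AB x Ax.
have /closure_id -> := compact_closed (@metric_hausdorff _ M) (@cmp_compact _ _ B).
move=> U /nbhs_ballP[e /= e0 eU].
have [|y By xy] := @set_dist_lt x B e.
  by apply: le_lt_trans e0; apply: le_trans (set_dist_excess B Ax) AB.
by exists y; split=> //; apply: eU; rewrite ballEmdist.
Qed.

Lemma set_excess_triangle B A C :
  set_excess A C <= set_excess A B + set_excess B C.
Proof.
apply: set_excess_le => x Ax.
apply: (@le_trans _ _ (set_dist x B + set_excess B C)); last first.
  by rewrite lerD2r; exact: set_dist_excess.
rewrite -lerBlDr; apply: le_set_dist => y By; rewrite lerBlDr.
apply: (@le_trans _ _ (mdist x y + set_dist y C)); last first.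
  by rewrite lerD2l; exact: set_dist_excess.
rewrite addrC -lerBlDr; apply: le_set_dist => z Cz; rewrite lerBlDr addrC.
by apply: le_trans (set_dist_le x Cz) (metric_triangle _ _ _).
Qed.

Let hausdorff_distxx A : hausdorff_dist A A = 0.
Proof. by rewrite /hausdorff_dist set_excessxx maxxx. Qed.

Let hausdorff_dist_positivity A B : hausdorff_dist A B = 0 -> A = B.
Proof.
move=> AB0; apply: cmp_plus_eq; apply/seteqP; split;
  by apply: set_excess_le0; rewrite -AB0 /hausdorff_dist le_max lexx ?orbT.
Qed.

Let hausdorff_dist_sym A B : hausdorff_dist A B = hausdorff_dist B A.
Proof. exact: maxC. Qed.

Let hausdorff_dist_triangle B A C :
  hausdorff_dist A C <= hausdorff_dist A B + hausdorff_dist B C.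
Proof.
rewrite {1}/hausdorff_dist ge_max; apply/andP; split.
  apply: le_trans (set_excess_triangle B A C) _.
  by apply: lerD; rewrite le_max lexx.
apply: le_trans (set_excess_triangle B C A) _; rewrite addrC.
by apply: lerD; rewrite le_max lexx orbT.
Qed.

HB.instance Definition _ := isMetric.Build R (cmp_plus M)
  hausdorff_distxx hausdorff_dist_positivity hausdorff_dist_sym
  hausdorff_dist_triangle.

Definition cmp_singleton (x : M) : cmp_plus M :=
  CmpPlus (@compact_set1 M x) (ex_intro _ x erefl).

(* [fine] only removes the coercion to the extended reals: on a tractable
   space the magnitude of a compact set is finite, see [mag_cmp_EFin]. *)
Definition mag_cmp (K : cmp_plus M) : R := fine (mag K).

Lemma mag_cmp_EFin (K : cmp_plus M) :
  tractable M -> (mag_cmp K)%:E = mag K.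
Proof.
move=> [_ tM]; apply: fineK; have [x _] := cmp_neq0 K.
have [r [r0 Kr]] := compact_mbounded x (@cmp_compact _ _ K).
rewrite fin_numE; apply/andP; split.
  rewrite gt_eqF//; apply: (@lt_le_trans _ _ (fset_mag (fset0 : {fset M}))%:E).
    exact: ltNyr.
  by apply: ereal_sup_ubound; exists fset0 => // y; rewrite /= inE.
rewrite lt_eqF//; apply: le_lt_trans (tM x r r0).2; apply: ereal_sup_le.
by move=> _ [F FK <-]; exists F => //; exact: subset_trans FK Kr.
Qed.

End HausdorffMetric.

(* Main.v *)
Require Import Defs.
From mathcomp Require Import all_boot all_order all_algebra.
From mathcomp Require Import finmap ring lra zify.
From mathcomp Require Import all_classical all_reals all_analysis.

Set Implicit Arguments.
Unset Strict Implicit.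
Unset Printing Implicit Defensive.

Import Order.TTheory GRing.Theory Num.Theory.
Import numFieldNormedType.Exports.

Local Open Scope classical_set_scope.
Local Open Scope ring_scope.

(** Let d be the metric of the norm. It is enough to bound the magnitude of every
    finite subset of a ball of radius r by exp (C * r), where C depends on the
    space only: a compact set close to {x} lies in a small ball around x, and the
    magnitude of a nonempty set is at least 1. Now mag F <= c as soon as
    (sum w) ^ 2 <= c * (w^T Z_F w) for all weights w ([fset_mag_le]), that is, as
    soon as exp (- d) dominates the constant kernel 1 / c. If the kernel C * r - d
    is positive semidefinite on the ball, then so are its powers by the Schur
    product theorem ([schur_psd]), hence exp (C * r - d) dominates 1
    ([qform_expR_ge]). By homogeneity, everything follows from a bound on the unit
    ball for the energy of weights of arbitrary signs ([ball_energy]):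

      sum_ij w_i w_j |x_i - x_j| <= C * (sum_i w_i) ^ 2.

    On an interval of the line this holds with C the length divided by 2, since
    |u - v| counts the cuts separating u from v. A norm such that all the kernels
    exp (- t * |x - y|) are positive semidefinite is an average of functions
    |theta x| over linear forms theta; the proof uses this embedding into L1 in the
    following quantitative and finite form.

    Restrict exp (- t * |x|) to the lattice spanned by finitely many vectors g_k. A
    discrete version of Bochner's theorem ([mean_wave]) writes it on any bounded
    part of the lattice, up to a factor tending to 1, as an average of
    cos (theta . c) over theta in a finite torus. A triangle wave is a combination
    of the waves 1 - cos (k u), for odd k, with weights of order 1 / k ^ 2
    ([tri_nat], [tri_coef_le], [tri_coef_ge]). Hence the average of the triangle
    wave at theta . c is a sum of terms 1 - exp (- t * k * |x|) with these
    weights. For small t it is equivalent to |x| * t * log (1 / t), up to a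
    constant: the harmonic series makes the part linear in |x| dominate all the
    others ([parallelepiped_energy]). On the other hand, for fixed theta, the
    triangle wave is a distance on a circle, and the cuts of the circle bound its
    energy by the values of the wave at the coordinates of theta
    ([qform_tri_le]). Averaging over theta bounds the energy on a parallelepiped
    by the sum of the lengths |g_k| of its edges.

    Finally, the unit ball is compact, and binary expansions with digits in a
    finite net approximate its points by points of parallelepipeds that have a
    common bound on the sum of the edges ([dyadic_approx]). *)

(** * Quadratic forms and the Schur product *)

Section QuadraticForms.
Context {R : realType} {I : finType}.
Implicit Types (N L : I -> I -> R) (w f : I -> R).

Definition qform N w : R := \sum_i \sum_j w i * w j * N i j.

Definition psd N : Prop := forall w, 0 <= qform N w.

Lemma eq_qform N L w : (forall i j, N i j = L i j) -> qform N w = qform L w.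
Proof.
by move=> NL; apply: eq_bigr => i _; apply: eq_bigr => j _; rewrite NL.
Qed.

Lemma qformD N L w : qform (fun i j => N i j + L i j) w = qform N w + qform L w.
Proof.
rewrite /qform -big_split; apply: eq_bigr => i _ /=.
by rewrite -big_split; apply: eq_bigr => j _ /=; rewrite mulrDr.
Qed.

Lemma qformZ a N w : qform (fun i j => a * N i j) w = a * qform N w.
Proof.
rewrite /qform mulr_sumr; apply: eq_bigr => i _ /=.
by rewrite mulr_sumr; apply: eq_bigr => j _ /=; rewrite mulrCA.
Qed.

Lemma qformN N w : qform (fun i j => - N i j) w = - qform N w.
Proof. by rewrite -mulN1r -qformZ; apply: eq_qform => i j; rewrite mulN1r. Qed.

Lemma qformB N L w : qform (fun i j => N i j - L i j) w = qform N w - qform L w.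
Proof. by rewrite qformD qformN. Qed.

Lemma qform_sum (J : Type) (r : seq J) (P : pred J) (F : J -> I -> I -> R) w :
  qform (fun i j => \sum_(k <- r | P k) F k i j) w =
  \sum_(k <- r | P k) qform (F k) w.
Proof.
rewrite [RHS]exchange_big; apply: eq_bigr => i _ /=.
rewrite [RHS]exchange_big; apply: eq_bigr => j _ /=.
by rewrite mulr_sumr.
Qed.

Lemma qform_rank1 f w :
  qform (fun i j => f i * f j) w = (\sum_i w i * f i) ^+ 2.
Proof.
rewrite expr2 mulr_suml; apply: eq_bigr => i _.
by rewrite mulr_sumr; apply: eq_bigr => j _; rewrite mulrACA.
Qed.

Lemma qform_const a w : qform (fun _ _ => a) w = a * (\sum_i w i) ^+ 2.
Proof.
transitivity (qform (fun i j => a * (1 * 1)) w).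
  by apply: eq_qform => i j; rewrite !mulr1.
rewrite qformZ (qform_rank1 (fun=> 1)); congr (_ * _ ^+ 2).
by apply: eq_bigr => i _; rewrite mulr1.
Qed.

Lemma qform_mul_rank1 N f w :
  qform (fun i j => f i * f j * N i j) w = qform N (fun i => w i * f i).
Proof. by apply: eq_bigr => i _; apply: eq_bigr => j _; ring. Qed.

Lemma le_norm_qform N (e : R) w : (forall i j, `|N i j| <= e) ->
  `|qform N w| <= e * (\sum_i `|w i|) ^+ 2.
Proof.
have -> : e * (\sum_i `|w i|) ^+ 2 = qform (fun _ _ => e) (fun i => `|w i|).
  by rewrite qform_const.
move=> Ne; apply: le_trans (ler_norm_sum _ _ _) _; apply: ler_sum => i _.
apply: le_trans (ler_norm_sum _ _ _) _; apply: ler_sum => j _.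
by rewrite !normrM ler_wpM2l// mulr_ge0.
Qed.

Lemma cvg_qform (Nn : nat -> I -> I -> R) N w :
  (forall i j, Nn n i j @[n --> \oo] --> N i j) ->
  qform (Nn n) w @[n --> \oo] --> qform N w.
Proof.
move=> NnN; rewrite /qform.
apply: cvg_big => [|i _]; first exact: add_continuous.
apply: cvg_big => [|j _]; first exact: add_continuous.
exact: cvgMl_tmp.
Qed.

Let bump (i0 : I) (a b : R) (i : I) k : R :=
  a * (k == i0)%:R + b * (k == i)%:R.

Let sum_bump i0 a b i (F : I -> R) :
  \sum_k bump i0 a b i k * F k = a * F i0 + b * F i.
Proof.
rewrite /bump.
under eq_bigr do rewrite mulrDl -!mulrA.
rewrite big_split -!mulr_sumr; congr (_ * _ + _ * _).
  by rewrite (bigD1 i0)//= eqxx mul1r big1 ?addr0// => k /negbTE->; rewrite mul0r.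
by rewrite (bigD1 i)//= eqxx mul1r big1 ?addr0// => k /negbTE->; rewrite mul0r.
Qed.

Let qform_bump N i0 a b i : (forall i j, N i j = N j i) ->
  qform N (bump i0 a b i) =
  a ^+ 2 * N i0 i0 + a * b * N i0 i *+ 2 + b ^+ 2 * N i i.
Proof.
move=> Nsym; rewrite /qform.
under eq_bigr do under eq_bigr do rewrite -mulrA.
under eq_bigr do rewrite -mulr_sumr sum_bump.
by rewrite sum_bump (Nsym i i0); ring.
Qed.

Lemma psd_diag N i : psd N -> 0 <= N i i.
Proof.
move=> /(_ (fun k => (k == i)%:R)); rewrite /qform (bigD1 i)//= (bigD1 i)//=.
rewrite eqxx !mul1r !big1 ?addr0// => k /negbTE->.
  by rewrite big1// => j _; rewrite !mul0r.
by rewrite mulr0 mul0r.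
Qed.

Lemma psd_diag0 N i j :
  (forall i j, N i j = N j i) -> psd N -> N i i = 0 -> N i j = 0.
Proof.
move=> Nsym Npsd Nii; have Njj := psd_diag j Npsd.
(* for w = a delta_i - N_ij delta_j the form is affine in a *)
have h a : 0 <= N i j ^+ 2 * (N j j - a *+ 2).
  have := Npsd (bump i a (- N i j) j); rewrite qform_bump// Nii => h.
  by apply: le_trans h _; rewrite le_eqVlt; apply/orP; left; apply/eqP; ring.
have := h (N j j / 2 + 1) => {}h.
have {h} : N i j ^+ 2 <= 0 by move: h; set x := N i j ^+ 2; lra.
by move=> h; apply/eqP; rewrite -sqrf_eq0 eq_le h sqr_ge0.
Qed.

(** Subtracting the rank one kernel of row i0 is completing a square: the value
    of the remainder at w is the minimum of the form of N over the weights that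
    differ from w at i0 only. *)
Let psd_elim N i0 : (forall i j, N i j = N j i) -> psd N -> 0 < N i0 i0 ->
  psd (fun i j => N i j - (N i0 i0)^-1 * (N i i0 * N j i0)).
Proof.
move=> Nsym Npsd N0 w.
rewrite qformB qformZ (qform_rank1 (fun i => N i i0)).
set s := \sum_i _.
have := Npsd (fun k => w k - s / N i0 i0 * (k == i0)%:R).
suff -> : qform N (fun k => w k - s / N i0 i0 * (k == i0)%:R) =
   qform N w - (N i0 i0)^-1 * s ^+ 2 by [].
rewrite /qform.
have inner i (a : R) : \sum_j a * (w j - s / N i0 i0 * (j == i0)%:R) * N i j =
    a * (\sum_j w j * N i j - s / N i0 i0 * N i i0).
  rewrite (eq_bigr (fun j => a * (w j * N i j) -
    a * (s / N i0 i0) * ((j == i0)%:R * N i j))); last by move=> j _; ring.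
  rewrite sumrB -!mulr_sumr [X in _ - _ * X](bigD1 i0)//= eqxx mul1r [X in N i i0 + X]big1.
    by rewrite addr0 mulrBr -[a * _ * _]mulrA.
  by move=> k /negbTE->; rewrite mul0r.
under eq_bigr do rewrite inner.
rewrite (eq_bigr (fun i => w i * (\sum_j w j * N i j) -
  s / N i0 i0 * (w i * N i i0) -
  (i == i0)%:R * (s / N i0 i0 * (\sum_j w j * N i j - s / N i0 i0 * N i i0)))); last first.
  by move=> i _; ring.
rewrite !sumrB -mulr_sumr -/s.
rewrite [X in _ - _ - X](bigD1 i0)//= eqxx mul1r [X in _ - (_ + X)]big1; last first.
  by move=> k /negbTE->; rewrite mul0r.
have -> : \sum_j w j * N i0 j = s by apply: eq_bigr => j _; rewrite Nsym.
have -> : \sum_i w i * (\sum_j w j * N i j) = \sum_i \sum_j w i * w j * N i j.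
  by apply: eq_bigr => i _; rewrite mulr_sumr; apply: eq_bigr => j _; rewrite mulrA.
by field; rewrite gt_eqF.
Qed.

(** Schur product theorem: N is a sum of rank one kernels (eliminate the nonzero
    diagonal entries one at a time), and multiplying L by f i * f j rescales
    the weights. *)
Lemma schur_psd N L : (forall i j, N i j = N j i) -> psd N -> psd L ->
  psd (fun i j => N i j * L i j).
Proof.
move=> Nsym Npsd Lpsd.
have [n] := ubnP #|[set i | N i i != 0]|%SET.
elim: n N Nsym Npsd => // n IH N Nsym Npsd; rewrite ltnS => cardN w.
have [N0|/existsNP[i0 /eqP Ni0]] := pselect (forall i, N i i = 0).
  rewrite (@eq_qform _ (fun _ _ => 0)) ?qform_const ?mul0r// => i j.
  by rewrite (psd_diag0 j Nsym Npsd (N0 i)) mul0r.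
have {}Ni0 : 0 < N i0 i0 by rewrite lt_def Ni0 psd_diag.
pose N' i j := N i j - (N i0 i0)^-1 * (N i i0 * N j i0).
have N'psd : psd N' by exact: psd_elim.
rewrite (@eq_qform _ (fun i j => N' i j * L i j +
  (N i0 i0)^-1 * (N i i0 * N j i0 * L i j))); last first.
  by move=> i j; rewrite /N'; ring.
rewrite qformD qformZ qform_mul_rank1 addr_ge0//; last first.
  by rewrite mulr_ge0// invr_ge0 ltW.
apply: IH => //; first by move=> i j; rewrite /N' Nsym [N i i0 * _]mulrC.
apply: leq_trans cardN; apply/proper_card/properP; split.
  apply/fintype.subsetP => i; rewrite !inE; apply: contra => /eqP Nii.
  by rewrite /N' Nii (psd_diag0 i0 Nsym Npsd Nii) mul0r mulr0 subr0.
exists i0; rewrite inE ?negbK; first by rewrite gt_eqF.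
apply/eqP; rewrite /N'.
by field; rewrite gt_eqF.
Qed.

Lemma psd_exprn N n : (forall i j, N i j = N j i) -> psd N ->
  psd (fun i j => N i j ^+ n).
Proof.
move=> Nsym Npsd; elim: n => [|n IH].
  by move=> w; rewrite (@eq_qform _ (fun _ _ => 1)) ?qform_const ?mul1r ?sqr_ge0.
by move=> w; rewrite (@eq_qform _ (fun i j => N i j * N i j ^+ n));
  [exact: (schur_psd Nsym Npsd IH)|by move=> i j; rewrite exprS].
Qed.

(** All the terms of the exponential series are positive semidefinite, and the
    first one is the constant kernel. *)
Lemma qform_expR_ge N w : (forall i j, N i j = N j i) -> psd N ->
  (\sum_i w i) ^+ 2 <= qform (fun i j => expR (N i j)) w.
Proof.
move=> Nsym Npsd.
pose S n := qform (fun i j => series (exp_coeff (N i j)) n) w.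
have Scvg : S @ \oo --> qform (fun i j => expR (N i j)) w.
  by apply: cvg_qform => i j; exact: is_cvg_series_exp_coeff.
rewrite -(cvg_lim _ Scvg)//; apply: limr_ge; first by apply/cvg_ex; eexists; exact: Scvg.
near=> n; have n0 : (0 < n)%N by near: n; exists 1%N.
rewrite /S /series/= qform_sum -[n]prednK//.
rewrite big_nat_recl//= (_ : qform _ w = (\sum_i w i) ^+ 2); last first.
  rewrite (@eq_qform _ (fun _ _ => 1)) ?qform_const ?mul1r// => i j.
  by rewrite exp_coeffE fact0 expr0 invr1 mul1r.
rewrite lerDl; apply: sumr_ge0 => k _.
rewrite (@eq_qform _ (fun i j => (k.+1`!%:R)^-1 * N i j ^+ k.+1)); last first.
  by move=> i j; rewrite exp_coeffE.
by rewrite qformZ mulr_ge0// psd_exprn.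
Unshelve. all: by end_near.
Qed.

End QuadraticForms.

Lemma qform_push {R : realType} (I K : finType) (f : I -> K) (N : K -> K -> R)
    (w : I -> R) :
  qform (fun i j => N (f i) (f j)) w = qform N (fun p => \sum_(i | f i == p) w i).
Proof.
rewrite /qform (partition_big f predT)//=; apply: eq_bigr => p _.
transitivity (\sum_(i | f i == p) \sum_q \sum_(j | f j == q) w i * w j * N p q).
  apply: eq_bigr => i /eqP <-; rewrite (partition_big f predT)//=.
  by apply: eq_bigr => q _; apply: eq_bigr => j /eqP <-.
rewrite exchange_big/=; apply: eq_bigr => q _; rewrite mulr_suml mulr_suml.
by apply: eq_bigr => i _; rewrite mulr_sumr mulr_suml.
Qed.

(** * The triangle wave as a positive combination of cosines *)

Section SineBounds.
Context {R : realType}.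
Implicit Types x : R.

Let sin_mvt x : 0 < x -> exists2 c : R, 0 < c < x & sin x = x * cos c.
Proof.
move=> x0; have [| c] := @MVT R sin cos 0 x x0 (fun y _ => is_derive_sin y).
- by apply: continuous_subspaceT => y; exact: continuous_sin.
- by rewrite in_itv/= => c0x; rewrite sin0 !subr0 mulrC => ->; exists c.
Qed.

Lemma sin_le_id x : 0 <= x -> sin x <= x.
Proof.
rewrite le_eqVlt => /predU1P[<-|x0]; first by rewrite sin0.
have [c _ ->] := sin_mvt x0.
by rewrite -[leRHS]mulr1 ler_wpM2l ?cos_le1//; exact: ltW.
Qed.

Let cos_piquarter : (cos (pi / 4) : R) ^+ 2 = 1 / 2.
Proof.
have := @cos_pihalf R.
have -> : pi / 2 = (pi / 4) *+ 2 :> R by lra.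
by rewrite cos_mulr2n => h; lra.
Qed.

Lemma sin_ge_quarter x : 0 <= x <= pi / 2 -> x / 4 <= sin x.
Proof.
move=> /andP[]; rewrite le_eqVlt => /predU1P[<-|x0 xpi].
  by rewrite sin0 mul0r.
have pi0 := pi_gt0 R; have pi4 : pi < 4 :> R by have := pihalf_lt2 R; lra.
have cq : 1 / 2 <= cos (pi / 4) :> R.
  have : 0 <= cos (pi / 4) :> R by apply: cos_ge0_pihalf; apply/andP; split; lra.
  by have := cos_piquarter; move: (cos _) => c; nra.
have small (y : R) : 0 < y -> y <= pi / 4 -> y / 2 <= sin y.
  move=> y0 ypi; have [c /andP[c0 cy] ->] := sin_mvt y0.
  apply: ler_wpM2l; first exact: ltW.
  apply: (@le_trans _ _ (cos (pi / 4))); first by lra.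
  by apply/ltW; rewrite ltr_cos ?in_itv/=; [lra|apply/andP; split; lra|apply/andP; split; lra].
have [xq|qx] := leP x (pi / 4); first by have := small x x0 xq; lra.
have sq : 1 / 2 <= sin (pi / 4) :> R.
  have -> : pi / 4 = pi / 2 - pi / 4 :> R by lra.
  by rewrite sinB sin_pihalf cos_pihalf mul0r subr0; lra.
apply: (@le_trans _ _ (sin (pi / 4))); first by lra.
by apply/ltW; rewrite ltr_sin ?in_itv/=; [|apply/andP; split; lra|apply/andP; split; lra].
Qed.

End SineBounds.

Section TriangleWave.
Context {R : realType} (Q : nat) (Q0 : (0 < Q)%N).

(** Half the angle (2 l + 1) * 2 pi / (4 Q): the wave has period 4 Q, and only its
    odd harmonics occur. *)
Definition tri_node l : R := pi * l.*2.+1%:R / (4 * Q)%:R.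

(** The second difference of 1 - cos (2 a u) at u = 0 is 4 sin (a) ^ 2; these weights
    make the contributions of all the harmonics equal. *)
Definition tri_coef l : R := ((4 * Q ^ 2)%:R * sin (tri_node l) ^+ 2)^-1.

Definition tri (u : R) : R :=
  \sum_(l < Q) tri_coef l * (1 - cos (tri_node l *+ 2 * u)).

Lemma tri_node_itv l : (l < Q)%N -> 0 < tri_node l < pi / 2.
Proof.
move=> lQ; have pi0 := pi_gt0 R; rewrite /tri_node; apply/andP; split.
  by rewrite divr_gt0 ?mulr_gt0 ?ltr0n ?muln_gt0.
rewrite ltr_pdivrMr ?ltr0n ?muln_gt0// -!mulrA ltr_pM2l//.
rewrite mulrC ltr_pdivlMr// -natrM ltr_nat; lia.
Qed.

Lemma sin_tri_node_gt0 l : (l < Q)%N -> 0 < sin (tri_node l).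
Proof. by move=> lQ; apply: sin_gt0_pihalf; exact: tri_node_itv. Qed.

Lemma tri_coef_ge0 l : 0 <= tri_coef l.
Proof. by rewrite invr_ge0 mulr_ge0 ?sqr_ge0. Qed.

Let coef_sin l : (l < Q)%N ->
  tri_coef l * sin (tri_node l) ^+ 2 = ((4 * Q ^ 2)%:R)^-1.
Proof.
move=> lQ; rewrite /tri_coef invfM mulfVK// sqrf_eq0 gt_eqF//.
exact: sin_tri_node_gt0.
Qed.

Lemma tri_coef_le l : (l < Q)%N -> tri_coef l <= 16 / l.*2.+1%:R ^+ 2.
Proof.
move=> lQ; have /andP[x0 xpi] := tri_node_itv lQ.
have k0 : 0 < l.*2.+1%:R :> R by rewrite ltr0n.
have Q0R : 0 < Q%:R :> R by rewrite ltr0n.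
have sx : l.*2.+1%:R / (8 * Q%:R) <= sin (tri_node l).
  apply: le_trans (sin_ge_quarter _); last by rewrite !ltW.
  have -> : tri_node l / 4 = l.*2.+1%:R / (8 * Q%:R) * (pi / 2).
    by rewrite /tri_node natrM; field; rewrite gt_eqF.
  by rewrite ler_peMr ?pihalf_ge1// ltW// divr_gt0// mulr_gt0.
rewrite /tri_coef -lef_pV2 ?posrE ?divr_gt0 ?exprn_gt0//; last first.
  rewrite invr_gt0 mulr_gt0 ?exprn_gt0 ?sin_tri_node_gt0//.
  by rewrite ltr0n muln_gt0 expn_gt0 Q0.
rewrite invrK invf_div natrM natrX.
apply: (@le_trans _ _ (4 * Q%:R ^+ 2 * (l.*2.+1%:R / (8 * Q%:R)) ^+ 2)).
  by rewrite le_eqVlt; apply/orP; left; apply/eqP; field; rewrite gt_eqF.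
rewrite ler_wpM2l// ler_sqr// ?nnegrE; first by rewrite divr_ge0 ?mulr_ge0 ?ltW.
by rewrite ltW// sin_tri_node_gt0.
Qed.

Lemma tri_coef_ge l : (l < Q)%N -> (4 * l.*2.+1%:R ^+ 2)^-1 <= tri_coef l.
Proof.
move=> lQ; have /andP[x0 xpi] := tri_node_itv lQ.
have k0 : 0 < l.*2.+1%:R :> R by rewrite ltr0n.
have Q0R : 0 < Q%:R :> R by rewrite ltr0n.
have s0 := sin_tri_node_gt0 lQ.
rewrite /tri_coef lef_pV2 ?posrE ?mulr_gt0 ?exprn_gt0//; last first.
  by rewrite ltr0n muln_gt0 expn_gt0 Q0.
have sx : sin (tri_node l) <= l.*2.+1%:R / Q%:R.
  apply: le_trans (sin_le_id (ltW x0)) _; rewrite /tri_node natrM.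
  rewrite [leLHS](_ : _ = pi / 4 * (l.*2.+1%:R / Q%:R)); last first.
    by field; rewrite gt_eqF.
  by rewrite ler_piMl ?divr_ge0 ?ltW//; have := pihalf_lt2 R; lra.
have sQ : Q%:R * sin (tri_node l) <= l.*2.+1%:R by rewrite mulrC -ler_pdivlMr.
rewrite natrM natrX -mulrA -exprMn ler_wpM2l// lerXn2r// nnegrE.
  by rewrite mulr_ge0// ltW.
exact: ltW.
Qed.

Lemma triN u : tri (- u) = tri u.
Proof. by apply: eq_bigr => l _; rewrite mulrN cosN. Qed.

Let sum_cos_odd (y : R) :
  \sum_(l < Q) 2 * sin y * cos (l.*2.+1%:R * y) = sin (Q.*2%:R * y).
Proof.
transitivity (\sum_(0 <= l < Q) (sin (l.+1.*2%:R * y) - sin (l.*2%:R * y))).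
  rewrite big_mkord; apply: eq_bigr => l _.
  rewrite (_ : l.+1.*2%:R * y = l.*2.+1%:R * y + y); last first.
    by rewrite doubleS -[in LHS]natr1; ring.
  rewrite (_ : l.*2%:R * y = l.*2.+1%:R * y - y); last first.
    by rewrite -[in RHS]natr1; ring.
  by rewrite sinD sinB; ring.
by rewrite telescope_sumr// mul0r sin0 subr0.
Qed.

Lemma sin_natpi n : sin (n%:R * pi) = 0 :> R.
Proof.
elim: n => [|n IH]; first by rewrite mul0r sin0.
by rewrite -natr1 mulrDl mul1r sinD IH sinpi mulr0 mul0r addr0.
Qed.

(** The second differences of tri vanish strictly between 0 and half its period,
    because the sum of the cosines of the odd multiples of an angle telescopes. *)
Lemma tri_nat n : (n <= Q.*2)%N -> tri n%:R = n%:R / Q.*2%:R.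
Proof.
have Q0R : Q%:R != 0 :> R by rewrite pnatr_eq0 -lt0n.
have Q2 : Q.*2%:R = 2 * Q%:R :> R by rewrite -mul2n natrM.
have cos2 l : 1 - cos (tri_node l *+ 2) = 2 * sin (tri_node l) ^+ 2.
  by rewrite cos_mulr2n sin2cos2; ring.
have tri1 : tri 1 = 1 / Q.*2%:R.
  rewrite /tri (eq_bigr (fun=> 2 / (4 * Q ^ 2)%:R)); last first.
    by move=> l _; rewrite mulr1 cos2 mulrCA coef_sin.
  by rewrite sumr_const card_ord Q2 -[X in X = _]mulr_natr natrM natrX; field.
have step k : (k.+1 < Q.*2)%N -> tri k.+2%:R - tri k.+1%:R = tri k.+1%:R - tri k%:R.
  move=> kQ; apply/eqP; rewrite -subr_eq0; apply/eqP.
  pose y : R := pi * k.+1%:R / Q.*2%:R.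
  have ynode l : tri_node l *+ 2 * k.+1%:R = l.*2.+1%:R * y.
    by rewrite /tri_node /y Q2 natrM; field.
  have siny : sin y != 0.
    rewrite gt_eqF// sin_gt0_pi//; have pi0 := pi_gt0 R; apply/andP; split.
      by rewrite divr_gt0 ?mulr_gt0 ?ltr0n ?double_gt0.
    by rewrite ltr_pdivrMr ?ltr0n ?double_gt0// ltr_pM2l// ltr_nat.
  transitivity (\sum_(l < Q) (Q ^ 2)%:R^-1 * cos (l.*2.+1%:R * y)); last first.
    rewrite -mulr_sumr; apply/eqP; rewrite mulf_eq0; apply/orP; right.
    have /eqP := sum_cos_odd y; rewrite -mulr_sumr.
    rewrite (_ : Q.*2%:R * y = k.+1%:R * pi); last by rewrite /y Q2; field.
    by rewrite sin_natpi mulf_eq0 mulf_eq0 pnatr_eq0/= (negbTE siny).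
  rewrite /tri -!sumrB; apply: eq_bigr => l _; rewrite -ynode.
  rewrite (_ : tri_node l *+ 2 * k.+2%:R =
               tri_node l *+ 2 * k.+1%:R + tri_node l *+ 2); last first.
    by rewrite -[in LHS]natr1; ring.
  rewrite (_ : tri_node l *+ 2 * k%:R =
               tri_node l *+ 2 * k.+1%:R - tri_node l *+ 2); last first.
    by rewrite -[in RHS]natr1; ring.
  set z := tri_node l *+ 2 * k.+1%:R; rewrite cosD cosB.
  transitivity (tri_coef l * (1 - cos (tri_node l *+ 2)) * (2 * cos z)); first by ring.
  rewrite cos2 [tri_coef l * _]mulrCA coef_sin// natrM natrX; field.
  by rewrite Q0R.
have diff k : (k < Q.*2)%N -> tri k.+1%:R - tri k%:R = 1 / Q.*2%:R.
  elim: k => [_|k IH kQ]; last by rewrite step// IH// ltnW.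
  rewrite tri1 [X in _ - X](_ : _ = 0) ?subr0//.
  by rewrite /tri big1// => l _; rewrite mulr0 cos0 subrr mulr0.
elim: n => [_|n IH nQ].
  by rewrite mul0r /tri big1// => l _; rewrite mulr0 cos0 subrr mulr0.
have /eqP := diff n nQ; rewrite subr_eq (IH (ltnW nQ)) => /eqP ->.
by rewrite -mulrDl addrC natr1.
Qed.

Lemma tri_int (z : int) : (`|z|%N <= Q.*2)%N ->
  tri z%:~R = `|z%:~R| / Q.*2%:R.
Proof.
move=> zQ; rewrite -intr_norm -natr_absz -(tri_nat zQ).
by case: z {zQ} => // n; rewrite NegzE mulrNz triN.
Qed.

Lemma sum_tri_coef : \sum_(l < Q) tri_coef l = 1 / 2.
Proof.
have := tri_nat (leqnn Q.*2); rewrite divff ?pnatr_eq0 ?double_eq0 -?lt0n//.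
rewrite /tri (eq_bigr (fun l : 'I_Q => tri_coef l * 2)) -?mulr_suml; first by lra.
move=> l _; rewrite (_ : _ *+ 2 * _ = l.*2.+1%:R * pi); last first.
  have -> : Q.*2%:R = 2 * Q%:R :> R by rewrite -mul2n natrM.
  by rewrite /tri_node natrM; field; rewrite pnatr_eq0 -lt0n.
rewrite -natr1 mulrDl mul1r cosD sinpi mulr0 subr0 cospi.
suff -> : cos (l.*2%:R * pi) = 1 :> R by congr (_ * _); ring.
elim: (nat_of_ord l) => [|k IH]; first by rewrite mul0r cos0.
by rewrite doubleS -addn2 natrD mulrDl [2%:R * _]mulr_natl cosD2pi.
Qed.

(** If Q <= U, only the total weight of the cosines matters. Otherwise the points
    lie on an arc where the wave is a multiple of the distance, which is the number
    of cuts separating two points; the energy of a cut of mass s out of W is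
    2 s (W - s) <= W ^ 2 / 2. *)
Lemma qform_tri_le (I : finType) (u : I -> int) (U : nat) (w : I -> R) :
  (forall i, (`|u i|%N <= U)%N) ->
  qform (fun i j => tri (u i - u j)%:~R) w <= U%:R / Q.*2%:R * (\sum_i w i) ^+ 2.
Proof.
move=> uU.
have Q2 : 0 < Q.*2%:R :> R by rewrite ltr0n double_gt0.
have [QU|UQ] := leqP Q U.
  apply: (@le_trans _ _ (1 / 2 * (\sum_i w i) ^+ 2)); last first.
    rewrite ler_wpM2r ?sqr_ge0// ler_pdivlMr//.
    by rewrite -mul2n natrM mulrA mulfVK// mul1r ler_nat.
  rewrite qform_sum -sum_tri_coef mulr_suml; apply: ler_sum => l _.
  rewrite qformZ ler_wpM2l ?tri_coef_ge0// qformB qform_const mul1r gerBl.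
  pose phi i := tri_node l *+ 2 * (u i)%:~R.
  rewrite (@eq_qform _ _ _ (fun i j => cos (phi i) * cos (phi j) + sin (phi i) * sin (phi j))).
    rewrite qformD (qform_rank1 (fun i => cos (phi i))).
    by rewrite (qform_rank1 (fun i => sin (phi i))) addr_ge0 ?sqr_ge0.
  by move=> i j; rewrite rmorphB mulrBr cosB.
pose a i := absz (u i + U%:Z).
have aU i : (a i <= U.*2)%N by have := uU i; rewrite /a; lia.
have aE i j : (u i - u j)%:~R = (a i)%:R - (a j)%:R :> R.
  rewrite !natr_absz -rmorphB/=; congr _%:~R.
  by have := uU i; have := uU j; lia.
pose cut (t : 'I_U.*2) i : R := (t < a i)%N%:R.
have sum_cut i : \sum_t cut t i = (a i)%:R.
  have -> : (a i)%:R = \sum_(t < a i) 1 :> R by rewrite sumr_const card_ord.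
  rewrite (big_ord_widen U.*2 (fun=> 1) (aU i)) [RHS]big_mkcond/=.
  by apply: eq_bigr => t _; rewrite /cut; case: ifP.
have cutE i j : tri (u i - u j)%:~R =
    Q.*2%:R^-1 * \sum_t (cut t i - cut t j) ^+ 2.
  rewrite tri_int; last by have := uU i; have := uU j; lia.
  rewrite mulrC; congr (_ * _); rewrite aE.
  wlog aij : i j / (a i <= a j)%N.
    move=> H; have [/H//|/ltnW/H] := leqP (a i) (a j).
    by rewrite distrC => ->; apply: eq_bigr => t _; rewrite -sqrrN opprB.
  rewrite distrC ger0_norm ?subr_ge0 ?ler_nat// -!sum_cut -sumrB.
  apply: eq_bigr => t _; rewrite /cut.
  have [tai|_] := ltnP t (a i); last
    by rewrite sub0r sqrrN subr0; case: ltnP; rewrite ?expr1n ?expr0n.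
  by rewrite (leq_trans tai aij) subrr expr0n.
rewrite (eq_qform _ cutE) qformZ qform_sum [X in _ <= X * _]mulrC -mulrA.
apply: ler_wpM2l; first by rewrite invr_ge0 ltW.
apply: (@le_trans _ _ (\sum_(t < U.*2) 1 / 2 * (\sum_i w i) ^+ 2)); last first.
  by rewrite sumr_const card_ord -mul2n -[leLHS]mulr_natl natrM; lra.
apply: ler_sum => t _.
have cut01 i : cut t i ^+ 2 = cut t i by rewrite /cut; case: ltnP; rewrite ?expr0n ?expr1n.
set W := \sum_i w i; pose s := \sum_i w i * cut t i.
suff -> : qform (fun i j => (cut t i - cut t j) ^+ 2) w = 2 * W * s - 2 * s ^+ 2.
  by have := sqr_ge0 (W - 2 * s); rewrite sqrrB; lra.
rewrite (@eq_qform _ _ _ (fun i j => cut t i * 1 + 1 * cut t j - 2 * (cut t i * cut t j))).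
  rewrite qformB qformZ qformD (qform_rank1 (cut t)) -/s.
  have -> : qform (fun i j => cut t i * 1) w = s * W.
    rewrite /qform /s mulr_suml; apply: eq_bigr => i _; rewrite mulr_sumr.
    by apply: eq_bigr => j _; ring.
  have -> : qform (fun i j => 1 * cut t j) w = W * s.
    rewrite /qform /W mulr_suml; apply: eq_bigr => i _; rewrite mulr_sumr.
    by apply: eq_bigr => j _; ring.
  by ring.
by move=> i j; rewrite sqrrB !cut01; ring.
Qed.

End TriangleWave.

(** * A finite form of Bochner's theorem *)

Section TorusSums.
Context {R : realType} (Q : nat) (Q0 : (0 < Q)%N) {N : nat}.
Implicit Types (c : 'I_N -> int) (t : {ffun 'I_N -> 'I_(4 * Q)}).

(** Representatives of the residues modulo 4 Q that are closest to 0, where the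
    triangle wave is proportional to the absolute value. *)
Definition centered t (k : 'I_N) : int := (t k : int) - Q.*2%:Z.

Definition dotz (s c : 'I_N -> int) : int := \sum_k s k * c k.

Definition frequency : R := pi / Q.*2%:R.

Let Q2 : Q.*2%:R != 0 :> R. Proof. by rewrite pnatr_eq0 double_eq0 -lt0n. Qed.

Lemma dotzB s c c' : dotz s (fun k => c k - c' k) = dotz s c - dotz s c'.
Proof. by rewrite -sumrB; apply: eq_bigr => k _; rewrite mulrBr. Qed.

Lemma dotzD s c c' : dotz s (fun k => c k + c' k) = dotz s c + dotz s c'.
Proof. by rewrite -big_split; apply: eq_bigr => k _; rewrite /= mulrDr. Qed.

Let cos_periodn x n : cos (x + 2 * pi * n%:R) = cos x :> R.
Proof.
elim: n => [|n IH]; first by rewrite mulr0 addr0.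
by rewrite -[n.+1%:R]natr1 mulrDr addrA mulr1 [2 * pi]mulr_natl cosD2pi -mulr_natl.
Qed.

Let cos_periodz x (z : int) : cos (x + 2 * pi * z%:~R) = cos x :> R.
Proof.
case: z => n; first exact: cos_periodn.
by rewrite NegzE mulrNz -(cos_periodn _ n.+1) mulrN addrNK.
Qed.

Lemma cos_frequency_period (z m : int) :
  cos (frequency * (z + (4 * Q)%:Z * m)%:~R) = cos (frequency * z%:~R).
Proof.
rewrite rmorphD rmorphM/= mulrDr -[RHS](cos_periodz _ m); congr (cos (_ + _)).
rewrite mulrA; congr (_ * _); rewrite /frequency -[_%:~R]/((4 * Q)%:R).
have -> : (4 * Q)%N = (2 * Q.*2)%N by lia.
by rewrite natrM; field.
Qed.

Lemma sin_frequency_period (z m : int) :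
  sin (frequency * (z + (4 * Q)%:Z * m)%:~R) = sin (frequency * z%:~R).
Proof.
have shift (x : int) : sin (frequency * x%:~R) = cos (frequency * (x - Q%:Z)%:~R).
  rewrite rmorphB mulrBr/= -cosBpihalf; congr (cos (_ - _)).
  by rewrite /frequency -mul2n natrM; field; rewrite pnatr_eq0 -lt0n.
by rewrite !shift -[in RHS](cos_frequency_period _ m) addrAC.
Qed.

Lemma cos_frequency_neq1 (z : int) : z != 0 -> (`|z|%N < 4 * Q)%N ->
  cos (frequency * z%:~R) != 1.
Proof.
move=> z0 zQ; have pi0 := pi_gt0 R.
have half : frequency * z%:~R = (pi * z%:~R / (4 * Q)%:R) *+ 2.
  by rewrite /frequency (_ : (4 * Q)%N = (2 * Q.*2)%N); [rewrite natrM; field|lia].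
rewrite half cos_mulr2n cos2sin2; set y := pi * _ / _.
suff : sin y ^+ 2 != 0 by apply: contra => /eqP; move: (sin y ^+ 2) => s h; apply/eqP; lra.
rewrite sqrf_eq0.
have y_norm : `|y| = pi * (`|z|%N)%:R / (4 * Q)%:R.
  by rewrite /y !normrM normfV natr_absz intr_norm (gtr0_norm pi0) normr_nat.
suff : sin `|y| != 0 by case: (leP 0 y) => [/ger0_norm|/ltr0_norm] ->//; rewrite sinN oppr_eq0.
rewrite gt_eqF// sin_gt0_pi// y_norm; apply/andP; split.
  by rewrite divr_gt0 ?mulr_gt0 ?ltr0n ?absz_gt0 ?muln_gt0.
by rewrite ltr_pdivrMr ?ltr0n ?muln_gt0// ltr_pM2l// ltr_nat.
Qed.

(** Adding 1 to one coordinate rotates the pair of the sums of the cosines and of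
    the sines by a fixed angle, so that this pair vanishes unless the angle does. *)
Lemma sum_torus_eq0 c : (exists k, c k != 0) -> (forall k, (`|c k|%N < 4 * Q)%N) ->
  \sum_t cos (frequency * (dotz (centered t) c)%:~R) = 0.
Proof.
move=> [k0 ck0] cQ.
pose shift t := [ffun k => if k == k0 then ordS (t k) else t k].
have shift_inj : injective shift.
  move=> t t' /ffunP tt'; apply/ffunP => k; have := tt' k; rewrite !ffunE.
  by case: ifP => // _; exact: (can_inj (@ordSK _)).
have shift_dot t : exists m, dotz (centered (shift t)) c =
    dotz (centered t) c + c k0 + (4 * Q)%:Z * m.
  exists (if (t k0).+1 == (4 * Q)%N then - c k0 else 0).
  rewrite /dotz (bigD1 k0)//= [in RHS](bigD1 k0)//=.
  rewrite (eq_bigr (fun k => centered t k * c k)); last first.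
    by move=> k /negbTE kk0; rewrite /centered ffunE kk0.
  rewrite /centered ffunE eqxx/=; move: (\sum_(i | _) _) => r.
  have := ltn_ord (t k0); rewrite leq_eqVlt.
  case: eqP => [e _|_ /= tQ]; first by rewrite e modnn; lia.
  by rewrite modn_small//; lia.
set S := \sum_t _; pose T := \sum_t sin (frequency * (dotz (centered t) c)%:~R).
set a := frequency * (c k0)%:~R.
have eS : S = S * cos a - T * sin a.
  rewrite {1}/S (reindex_inj shift_inj)/= !mulr_suml -sumrB.
  apply: eq_bigr => t _; have [m ->] := shift_dot t.
  by rewrite cos_frequency_period rmorphD mulrDr cosD.
have eT : T = T * cos a + S * sin a.
  rewrite {1}/T (reindex_inj shift_inj)/= !mulr_suml -big_split/=.
  apply: eq_bigr => t _; have [m ->] := shift_dot t.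
  by rewrite sin_frequency_period rmorphD mulrDr sinD.
have ca : cos a != 1 by exact: cos_frequency_neq1.
have : S * ((1 - cos a) ^+ 2 + sin a ^+ 2) = 0.
  transitivity ((S - (S * cos a - T * sin a)) * (1 - cos a) +
                (T * cos a + S * sin a - T) * sin a); first by ring.
  by rewrite -eS -eT !subrr !mul0r addr0.
move/eqP; rewrite mulf_eq0 => /orP[/eqP//|].
by rewrite paddr_eq0 ?sqr_ge0// !sqrf_eq0 subr_eq0 eq_sym (negbTE ca).
Qed.

Lemma sum_torus c : (forall k, (`|c k|%N < 4 * Q)%N) ->
  \sum_t cos (frequency * (dotz (centered t) c)%:~R) =
  (4 * Q)%:R ^+ N * [forall k, c k == 0]%:R.
Proof.
move=> cQ; case: forallP => [c0|/forallP]; last first.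
  by rewrite negb_forall mulr0 => /existsP ck; exact: sum_torus_eq0.
rewrite mulr1 (eq_bigr (fun=> 1)); last first.
  by move=> t _; rewrite /dotz big1 ?mulr0 ?cos0// => k _; rewrite (eqP (c0 k)) mulr0.
by rewrite sumr_const card_ffun !card_ord natrX.
Qed.

End TorusSums.

Section FiniteBochner.
Context {R : realType} (Q : nat) (Q0 : (0 < Q)%N) {N : nat}.
Variable kappa : ('I_N -> int) -> R.
Hypothesis kappa_psd : forall (J : finType) (x : J -> 'I_N -> int),
  psd (fun i j => kappa (fun k => x i k - x j k)).
Hypothesis kappaN : forall c, kappa (fun k => - c k) = kappa c.
Hypothesis kappa0 : kappa (fun=> 0) = 1.
Implicit Types (c : 'I_N -> int) (t : {ffun 'I_N -> 'I_(4 * Q)})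
  (b : {ffun 'I_N -> 'I_Q}).

Let gap b b' k : int := (b k : int) - (b' k : int).

Let wave t c : R := cos (frequency Q * (dotz (centered t) c)%:~R).

(** The spectral density of kappa, smoothed by restricting the kernel to a cube of
    side Q. The torus has side 4 Q, so that a difference of points of the cube and
    a vector with entries of absolute value at most 2 Q coincide as soon as they
    are congruent. *)
Definition spectral t : R :=
  \sum_b \sum_b' kappa (gap b b') * wave t (gap b b').

(** The cosine of a difference is a sum of two rank one kernels. *)
Lemma spectral_ge0 t : 0 <= spectral t.
Proof.
pose phi b : R := frequency Q * (dotz (centered t) (fun k => (b k : int)))%:~R.
have -> : spectral t = qform (fun b b' => kappa (gap b b')) (fun b => cos (phi b)) +
                       qform (fun b b' => kappa (gap b b')) (fun b => sin (phi b)).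
  rewrite -big_split; apply: eq_bigr => b _; rewrite -big_split; apply: eq_bigr => b' _.
  by rewrite /wave dotzB rmorphB mulrBr cosB -/(phi b) -/(phi b') /= -mulrDl mulrC.
by rewrite addr_ge0// (kappa_psd (fun b k => (b k : int))).
Qed.

(** The size of the intersection of the interval of length Q with its translate
    by z; divided by Q, this is Fejer's factor. *)
Definition overlap (z : int) : R := \sum_(i < Q) \sum_(j < Q) ((i : int) - (j : int) == z)%:R.

Let prod_overlap c : \prod_k overlap (c k) =
  \sum_b \sum_b' [forall k, gap b b' k == c k]%:R.
Proof.
rewrite /overlap bigA_distr_bigA; apply: eq_bigr => b _.
rewrite bigA_distr_bigA; apply: eq_bigr => b' _ /=.
case: forallP => [e|/forallP]; first by rewrite big1// => k _; rewrite e.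
by rewrite negb_forall => /existsP[k /negbTE e]; rewrite (bigD1 k)//= e mul0r.
Qed.

(** Fourier inversion on the torus: the differences c and - c are the only ones that
    survive the summation over t. *)
Lemma sum_spectral c : (forall k, (`|c k|%N <= Q.*2)%N) ->
  \sum_t spectral t * wave t c =
  (4 * Q)%:R ^+ N * (kappa c * \prod_k overlap (c k)).
Proof.
move=> cQ.
transitivity (\sum_b \sum_b' kappa (gap b b') * \sum_t (wave t (gap b b') * wave t c)).
  rewrite /spectral; under eq_bigr do rewrite mulr_suml.
  rewrite exchange_big; apply: eq_bigr => b _ /=.
  under eq_bigr do rewrite mulr_suml.
  rewrite exchange_big; apply: eq_bigr => b' _ /=.
  by rewrite mulr_sumr; apply: eq_bigr => t _; rewrite mulrA.
have prodwave b b' : \sum_t (wave t (gap b b') * wave t c) = (4 * Q)%:R ^+ N / 2 *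
    ([forall k, gap b b' k == c k]%:R + [forall k, gap b' b k == c k]%:R).
  transitivity (1 / 2 * (\sum_t wave t (fun k => gap b b' k - c k) +
                         \sum_t wave t (fun k => gap b b' k + c k))).
    rewrite -big_split mulr_sumr; apply: eq_bigr => t _ /=.
    rewrite /wave dotzB dotzD rmorphB rmorphD/=.
    by rewrite [frequency Q * (_ - _)]mulrBr [frequency Q * (_ + _)]mulrDr cosB cosD; field.
  have gapQ k : (`|gap b b' k|%N < Q)%N.
    by have := ltn_ord (b k); have := ltn_ord (b' k); rewrite /gap; lia.
  rewrite /wave !sum_torus//; last 2 first.
  - by move=> k; have := gapQ k; have := cQ k; lia.
  - by move=> k; have := gapQ k; have := cQ k; lia.
  rewrite (eq_forallb (_ : forall k, (gap b b' k - c k == 0) = (gap b b' k == c k))); last first.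
    by move=> k; rewrite subr_eq0.
  rewrite (eq_forallb (_ : forall k, (gap b b' k + c k == 0) = (gap b' b k == c k))); last first.
    by move=> k; rewrite /gap; lia.
  by field.
have half b b' : kappa (gap b b') * ((4 * Q)%:R ^+ N / 2 *
    ([forall k, gap b b' k == c k]%:R + [forall k, gap b' b k == c k]%:R)) =
  (4 * Q)%:R ^+ N * (kappa c / 2) * [forall k, gap b b' k == c k]%:R +
  (4 * Q)%:R ^+ N * (kappa c / 2) * [forall k, gap b' b k == c k]%:R.
  have -> : kappa (gap b b') * ((4 * Q)%:R ^+ N / 2 *
    ([forall k, gap b b' k == c k]%:R + [forall k, gap b' b k == c k]%:R)) =
    (4 * Q)%:R ^+ N / 2 * (kappa (gap b b') * [forall k, gap b b' k == c k]%:R) +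
    (4 * Q)%:R ^+ N / 2 * (kappa (gap b b') * [forall k, gap b' b k == c k]%:R) by ring.
  congr (_ + _).
    case: forallP => [e|_]; last by rewrite !mulr0.
    by rewrite (_ : gap b b' = c); [ring|apply/funext => k; exact/eqP].
  case: forallP => [e|_]; last by rewrite !mulr0.
  rewrite (_ : gap b b' = fun k => - c k); first by rewrite kappaN; ring.
  by apply/funext => k; rewrite -(eqP (e k)) /gap opprB.
rewrite (eq_bigr (fun b => (4 * Q)%:R ^+ N * (kappa c / 2) *
     (\sum_b' [forall k, gap b b' k == c k]%:R) + (4 * Q)%:R ^+ N * (kappa c / 2) *
     (\sum_b' [forall k, gap b' b k == c k]%:R))); last first.
  move=> b _; rewrite !mulr_sumr -big_split; apply: eq_bigr => b' _ /=.
  by rewrite prodwave half.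
rewrite big_split/= -!mulr_sumr -prod_overlap exchange_big/= -prod_overlap.
by field.
Qed.

Lemma overlap0 : overlap 0 = Q%:R.
Proof.
rewrite /overlap (eq_bigr (fun=> 1)) ?sumr_const ?card_ord// => i _.
rewrite (bigD1 i)//= subrr eqxx big1 ?addr0// => j ji.
by apply/eqP; rewrite pnatr_eq0 eqb0 subr_eq0; apply: contra ji => /eqP[] /val_inj->.
Qed.

Definition mean_of (f : {ffun 'I_N -> 'I_(4 * Q)} -> R) : R :=
  ((4 * Q)%:R ^+ N * Q%:R ^+ N)^-1 * \sum_t spectral t * f t.

Let mass_gt0 : 0 < (4 * Q)%:R ^+ N * Q%:R ^+ N :> R.
Proof. by rewrite mulr_gt0 ?exprn_gt0 ?ltr0n ?muln_gt0. Qed.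

Lemma le_mean f g : (forall t, f t <= g t) -> mean_of f <= mean_of g.
Proof.
move=> fg; apply: ler_wpM2l; first by rewrite invr_ge0 ltW.
apply: ler_sum => t _.
by rewrite ler_wpM2l ?spectral_ge0.
Qed.

Lemma meanZ a f : mean_of (fun t => a * f t) = a * mean_of f.
Proof.
rewrite /mean_of mulrCA; congr (_ * _); rewrite mulr_sumr.
by apply: eq_bigr => t _; rewrite mulrCA.
Qed.

Lemma mean_sum (J : Type) (r : seq J) (P : pred J) (F : J -> {ffun 'I_N -> 'I_(4 * Q)} -> R) :
  mean_of (fun t => \sum_(j <- r | P j) F j t) = \sum_(j <- r | P j) mean_of (F j).
Proof.
rewrite /mean_of -mulr_sumr; congr (_ * _).
rewrite exchange_big; apply: eq_bigr => t _ /=.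
by rewrite mulr_sumr.
Qed.

Lemma mean_wave c : (forall k, (`|c k|%N <= Q.*2)%N) ->
  mean_of (wave^~ c) = kappa c * \prod_k (overlap (c k) / Q%:R).
Proof.
move=> cQ; rewrite /mean_of sum_spectral// prodf_div prodr_const card_ord.
have Qn : Q%:R != 0 :> R by rewrite pnatr_eq0 -lt0n.
have Q4n : (4 * Q)%:R != 0 :> R by rewrite pnatr_eq0 -lt0n muln_gt0.
by field; rewrite !expf_neq0.
Qed.

Lemma mean1 : mean_of (fun=> 1) = 1.
Proof.
transitivity (mean_of (wave^~ (fun=> 0))).
  congr mean_of; apply/funext => t; rewrite /wave /dotz big1 ?mulr0 ?cos0// => k _.
  by rewrite mulr0.
rewrite mean_wave// kappa0 overlap0 big1 ?mulr1// => k _.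
by rewrite divff// pnatr_eq0 -lt0n.
Qed.

Lemma mean_wave_norm c : `|mean_of (wave^~ c)| <= 1.
Proof.
rewrite ler_norml -mean1; apply/andP; split.
  by rewrite -mulN1r -meanZ; apply: le_mean => t; rewrite mulr1 cos_geN1.
by apply: le_mean => t; rewrite cos_le1.
Qed.

Definition mean_tri c : R := mean_of (fun t => tri Q (dotz (centered t) c)%:~R).

Lemma mean_triE c : mean_tri c =
  \sum_(l < Q) tri_coef Q l * (1 - mean_of (wave^~ (fun k => l.*2.+1%:Z * c k))).
Proof.
rewrite /mean_tri /tri mean_sum; apply: eq_bigr => l _; rewrite meanZ; congr (_ * _).
rewrite -[in RHS]mean1 -mulN1r -meanZ.
have -> : mean_of (fun=> 1) + mean_of (fun t => -1 * wave t (fun k => l.*2.+1%:Z * c k)) =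
  mean_of (fun t => 1 - wave t (fun k => l.*2.+1%:Z * c k)).
  rewrite /mean_of -mulrDr -big_split; congr (_ * _); apply: eq_bigr => t _ /=.
  by rewrite mulN1r mulrDr.
congr mean_of; apply/funext => t; congr (1 - cos _).
rewrite (_ : dotz _ (fun k => l.*2.+1%:Z * c k) = l.*2.+1%:Z * dotz (centered t) c); last first.
  by rewrite /dotz mulr_sumr; apply: eq_bigr => k _; rewrite mulrCA.
rewrite rmorphM mulrA/=; congr (_ * _).
rewrite /tri_node /frequency -[_%:~R]/(l.*2.+1%:R).
have -> : Q.*2%:R = 2 * Q%:R :> R by rewrite -mul2n natrM.
by rewrite natrM; field; rewrite pnatr_eq0 -lt0n.
Qed.

(** For a fixed t, the points of the circle given by the a i are at distance at most
    A times the sum of the |t k| from 0, and |t k| is 2 Q times the wave at t k.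
    Hence the one-dimensional bound is linear in the values of the wave, and it
    survives the averaging. *)
Lemma qform_mean_tri_le (I : finType) (a : I -> 'I_N -> int) (A : nat) (w : I -> R) :
  (forall i k, (`|a i k|%N <= A)%N) ->
  qform (fun i j => mean_tri (fun k => a i k - a j k)) w <=
  A%:R * (\sum_k mean_tri (fun k' => (k' == k)%:R)) * (\sum_i w i) ^+ 2.
Proof.
move=> aA.
pose D t i := dotz (centered t) (a i).
have -> : qform (fun i j => mean_tri (fun k => a i k - a j k)) w =
    mean_of (fun t => qform (fun i j => tri Q (D t i - D t j)%:~R) w).
  rewrite mean_sum; apply: eq_bigr => i _; rewrite mean_sum; apply: eq_bigr => j _.
  rewrite meanZ; congr (_ * mean_of _); apply/funext => t.
  by rewrite dotzB.
have -> : A%:R * (\sum_k mean_tri (fun k' => (k' == k)%:R)) * (\sum_i w i) ^+ 2 =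
    mean_of (fun t => (\sum_i w i) ^+ 2 * (A%:R *
      \sum_k tri Q (centered t k)%:~R)).
  rewrite meanZ meanZ mean_sum mulrC; congr (_ * (_ * _)); apply: eq_bigr => k _.
  congr mean_of; apply/funext => t; congr (tri Q _%:~R).
  rewrite /dotz (bigD1 k)//= eqxx mulr1 big1 ?addr0// => k' /negbTE->.
  by rewrite mulr0.
apply: le_mean => t.
have Dle i : (`|D t i|%N <= A * \sum_k `|centered t k|%N)%N.
  rewrite -lez_nat abszE /D /dotz; apply: le_trans (ler_norm_sum _ _ _) _.
  rewrite PoszM (big_morph Posz PoszD (erefl _)) mulr_sumr; apply: ler_sum => k _.
  by rewrite normrM mulrC abszE ler_wpM2r// -abszE lez_nat.
apply: le_trans (qform_tri_le Q0 w Dle) _; rewrite mulrC ler_wpM2l ?sqr_ge0//.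
rewrite natrM -mulrA ler_wpM2l// natr_sum mulr_suml le_eqVlt; apply/orP; left; apply/eqP.
apply: eq_bigr => k _; rewrite tri_int//; first by rewrite natr_absz intr_norm.
by have := ltn_ord (t k); rewrite /centered; lia.
Qed.

End FiniteBochner.

(** * The energy of weights in a parallelepiped *)

Lemma eventually_forall_fin (I : finType) (P : I -> nat -> Prop) :
  (forall i, \forall n \near \oo, P i n) -> \forall n \near \oo, forall i, P i n.
Proof.
move=> Pn.
have /choice[n0 Pn0] : forall i, exists n0, forall n, (n0 <= n)%N -> P i n.
  by move=> i; have [n0 _ h] := Pn i; exists n0 => n; exact: h.
exists (\max_i n0 i) => // n /= hn i; apply: Pn0; apply: leq_trans hn.
exact: (leq_bigmax i).
Qed.

Section OverlapLimits.
Context {R : realType}.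

Lemma overlap_le Q (z : int) : overlap Q z <= Q%:R :> R.
Proof.
rewrite -[leRHS](_ : \sum_(i < Q) 1 = _); last by rewrite sumr_const card_ord.
apply: ler_sum => i _.
have [/existsP[j0 /eqP ij0]|/existsPn none] := boolP [exists j : 'I_Q, (i : int) - (j : int) == z].
  rewrite (bigD1 j0)//= ij0 eqxx big1 ?addr0// => j jj0.
  apply/eqP; rewrite pnatr_eq0 eqb0; apply: contra jj0 => /eqP ij.
  by apply/eqP/val_inj => /=; lia.
by rewrite big1 ?ler01// => j _; rewrite (negbTE (none j)).
Qed.

Let overlap_nat_ge Q (n : nat) : Q%:R - n%:R <= overlap Q n%:Z :> R.
Proof.
have [Qn|nQ] := leqP Q n.
  apply: (@le_trans _ _ 0); first by rewrite subr_le0 ler_nat.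
  by apply: sumr_ge0 => i _; apply: sumr_ge0.
rewrite -natrB; last exact: ltnW.
rewrite /overlap exchange_big/=.
have -> : (Q - n)%:R = \sum_(j < Q - n) 1 :> R by rewrite sumr_const card_ord.
rewrite (big_ord_widen Q (fun=> 1)) ?leq_subr// big_mkcond/=.
apply: ler_sum => j _; case: ifPn => jn; last by apply: sumr_ge0.
have jnQ : (j + n < Q)%N by lia.
rewrite (bigD1 (Ordinal jnQ))//= (_ : _ == _ = true) ?lerDl ?sumr_ge0//.
by apply/eqP; lia.
Qed.

Lemma overlap_ge Q (z : int) : Q%:R - (`|z|%N)%:R <= overlap Q z :> R.
Proof.
case: z => n; first exact: overlap_nat_ge.
apply: le_trans (overlap_nat_ge Q n.+1) _.
rewrite /overlap exchange_big/= le_eqVlt; apply/orP; left; apply/eqP.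
apply: eq_bigr => i _; apply: eq_bigr => j _; congr (_%:R); congr nat_of_bool.
by rewrite NegzE; lia.
Qed.

Lemma cvg_overlap (z : int) : overlap Q z / Q%:R @[Q --> \oo] --> (1 : R).
Proof.
apply: (@squeeze_cvgr _ _ _ _ (fun Q => 1 - (`|z|%N)%:R * Q%:R^-1) (fun=> 1)).
- near=> Q; have Q0 : 0 < Q%:R :> R by rewrite ltr0n; near: Q; exists 1%N.
  rewrite ler_pdivrMr// ler_pdivlMr// mul1r overlap_le andbT.
  by rewrite mulrBl mul1r mulfVK ?gt_eqF// overlap_ge.
- rewrite -[X in _ --> X]subr0; apply: cvgB; first exact: cvg_cst.
  rewrite -[X in _ --> X](mulr0 (`|z|%N)%:R); apply: cvgMl_tmp.
  rewrite -cvg_shiftS; exact: cvg_harmonic.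
- exact: cvg_cst.
Unshelve. all: by end_near.
Qed.

End OverlapLimits.

Section TriCoefficients.
Context {R : realType} (Q : nat) (Q0 : (0 < Q)%N).

Lemma sum_tri_coef_tail n : (0 < n)%N ->
  \sum_(n <= l < Q) tri_coef Q l <= 4 / n%:R :> R.
Proof.
move=> n0.
have term l : (0 < l)%N -> (l < Q)%N -> tri_coef Q l <= 4 * (l%:R^-1 - l.+1%:R^-1) :> R.
  move=> l0 lQ; apply: le_trans (tri_coef_le Q0 lQ) _.
  have l0R : 0 < l%:R :> R by rewrite ltr0n.
  have -> : l.*2.+1%:R = 2 * l%:R + 1 :> R by rewrite -[l.*2.+1%:R]natr1 -mul2n natrM.
  rewrite -[l.+1%:R]natr1; move: (l%:R : R) l0R => x x0.
  rewrite (_ : 4 * (x^-1 - (x + 1)^-1) = 4 / (x * (x + 1))); last first.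
    by field; rewrite !gt_eqF//; lra.
  have d1 : 0 < (2 * x + 1) ^+ 2 by rewrite exprn_gt0//; lra.
  have d2 : 0 < x * (x + 1) by rewrite mulr_gt0//; lra.
  by rewrite ler_pdivrMr// mulrAC ler_pdivlMr//; nra.
have [Qn|nQ] := leqP Q n; first by rewrite big_geq// divr_ge0.
apply: (@le_trans _ _ (\sum_(n <= l < Q) 4 * (l%:R^-1 - l.+1%:R^-1))).
  rewrite !big_nat; apply: ler_sum => l /andP[nl lQ].
  by apply: term => //; exact: leq_trans nl.
rewrite -mulr_sumr ler_wpM2l//.
rewrite (telescope_sumr_eq (fun l => - l%:R^-1)) ?(ltnW nQ)//; last by move=> l _; ring.
by rewrite opprK gerDr oppr_le0 invr_ge0.
Qed.

End TriCoefficients.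

Section ExponentialBounds.
Context {R : realType}.
Implicit Types x s d : R.

Lemma oneB_expRN_le x : 1 - expR (- x) <= x.
Proof. by have := expR_ge1Dx (- x); lra. Qed.

Lemma oneB_expRN_ge x : 0 <= x -> x / (1 + x) <= 1 - expR (- x).
Proof.
move=> x0; rewrite expRN lerBrDr -lerBrDl.
rewrite (_ : 1 - x / (1 + x) = (1 + x)^-1); last by field; rewrite gt_eqF//; lra.
by rewrite lef_pV2 ?posrE ?expR_gt0 ?expR_ge1Dx//; lra.
Qed.

Lemma oneB_expRN_ge2 x : 0 <= x -> x - x ^+ 2 <= 1 - expR (- x).
Proof.
move=> x0; apply: le_trans (oneB_expRN_ge x0); rewrite ler_pdivlMr; last by lra.
by rewrite -subr_ge0 (_ : _ - _ = x ^+ 3); [rewrite exprn_ge0|ring].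
Qed.

Lemma oneB_expRN_scale s d : 0 <= s -> 0 <= d ->
  `|1 - expR (- (s * d)) - d * (1 - expR (- s))| <= (d + d ^+ 2) * s ^+ 2.
Proof.
move=> s0 d0; have sd0 : 0 <= s * d by exact: mulr_ge0.
have := oneB_expRN_le (s * d); have := oneB_expRN_ge2 sd0.
have := ler_wpM2l d0 (oneB_expRN_le s).
have := ler_wpM2l d0 (oneB_expRN_ge2 s0).
have : 0 <= d * s ^+ 2 by rewrite mulr_ge0 ?sqr_ge0.
have : 0 <= d ^+ 2 * s ^+ 2 by rewrite mulr_ge0 ?sqr_ge0.
by rewrite ler_norml => *; apply/andP; split; lra.
Qed.

End ExponentialBounds.

Section ParallelepipedEnergy.
Context {R : realType} {V : normedModType R}.
Hypothesis expdist_psd : forall (J : finType) (x : J -> V),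
  psd (fun i j => expR (- `|x i - x j|)).
Context {N : nat} (g : 'I_N -> V).
Implicit Types c : 'I_N -> int.

Definition lattice_point c : V := \sum_k (c k)%:~R *: g k.

Lemma lattice_pointB c c' :
  lattice_point (fun k => c k - c' k) = lattice_point c - lattice_point c'.
Proof. by rewrite -sumrB; apply: eq_bigr => k _; rewrite rmorphB scalerBl. Qed.

Lemma lattice_pointZ (m : int) c :
  lattice_point (fun k => m * c k) = m%:~R *: lattice_point c.
Proof.
by rewrite scaler_sumr; apply: eq_bigr => k _; rewrite rmorphM scalerA.
Qed.

Let kappa n c : R := expR (- (n%:R^-1 * `|lattice_point c|)).

Let kappa_psd n (J : finType) (x : J -> 'I_N -> int) :
  psd (fun i j => kappa n (fun k => x i k - x j k)).
Proof.
move=> w; have := expdist_psd (fun i => n%:R^-1 *: lattice_point (x i)) w.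
congr (_ <= _); apply: eq_qform => i j.
by rewrite /kappa -scalerBr normrZ ger0_norm ?invr_ge0// lattice_pointB.
Qed.

Let lattice_pointN c : lattice_point (fun k => - c k) = - lattice_point c.
Proof. by rewrite -sumrN; apply: eq_bigr => k _; rewrite rmorphN scaleNr. Qed.

Let kappaN n c : kappa n (fun k => - c k) = kappa n c.
Proof. by rewrite /kappa lattice_pointN normrN. Qed.

Let kappa0 n : kappa n (fun=> 0) = 1.
Proof.
by rewrite /kappa /lattice_point big1 ?normr0 ?mulr0 ?oppr0 ?expR0// => k _; rewrite scale0r.
Qed.

Let gain Q n : R := \sum_(0 <= l < n) tri_coef Q l * (1 - expR (- (l.*2.+1%:R / n%:R))).

(* 8 for the harmonics above n, 1 for the limit in Q, the rest for those below n *)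
Let err c : R := 9 + 16 * (`|lattice_point c| + `|lattice_point c| ^+ 2).

(** At scale 1 / n, the harmonic k contributes 1 - exp (- k d / n), whose deviation
    from a linear function of d is of order (k / n) ^ 2. As the weights are of order
    1 / k ^ 2, the harmonics below n deviate by O (1 / n) altogether; those above n
    have a total weight of O (1 / n). *)
Let mean_tri_linear n c : (0 < n)%N -> \forall Q \near \oo,
  `|mean_tri Q (kappa n) c - `|lattice_point c| * gain Q n| <= err c / n%:R.
Proof.
move=> n0; have n0R : 0 < n%:R :> R by rewrite ltr0n.
pose wav Q l := @mean_of R Q N (kappa n)
  (fun t => cos (frequency Q * (dotz (centered t) (fun k => l.*2.+1%:Z * c k))%:~R)).
have wav_lim : \forall Q \near \oo, forall l : 'I_n,
    `|kappa n (fun k => l.*2.+1%:Z * c k) - wav Q l| <= n%:R^-1.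
  apply: eventually_forall_fin => l; set kap := kappa n _.
  pose c' k := l.*2.+1%:Z * c k.
  have lim : kap * (\prod_k (overlap Q (c' k) / Q%:R)) @[Q --> \oo] --> kap.
    rewrite -[X in _ --> X]mulr1; apply: cvgMl_tmp.
    rewrite [X in _ --> X](_ : 1 = \prod_(k < N) (1 : R)); last by rewrite big1.
    apply: cvg_big => [|k _]; [exact: mul_continuous|exact: cvg_overlap].
  have small : \forall Q \near \oo, forall k, (`|c' k|%N <= Q.*2)%N.
    apply: eventually_forall_fin => k; exists `|c' k|%N => // Q /= h.
    by apply: leq_trans h _; rewrite -addnn leq_addr.
  near=> Q.
  rewrite /wav mean_wave//.
  - near: Q; move: lim => /cvgrPdist_le; apply; rewrite invr_gt0//.
  - by near: Q; exists 1%N.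
  - by near: Q.
near=> Q.
have Q0 : (0 < Q)%N by near: Q; exists 1%N.
have nQ : (n <= Q)%N by near: Q; exists n.
have tri0 := @tri_coef_ge0 R Q.
rewrite mean_triE//; set d := `|lattice_point c|.
have d0 : 0 <= d by exact: normr_ge0.
rewrite -(big_mkord xpredT (fun l => tri_coef Q l * (1 - wav Q l))).
rewrite (big_cat_nat (n := n))//= addrAC /gain mulr_sumr -sumrB.
apply: le_trans (ler_normD _ _) _.
have tail : `|\sum_(n <= l < Q) tri_coef Q l * (1 - wav Q l)| <= 8 / n%:R.
  apply: le_trans (ler_norm_sum _ _ _) _.
  apply: (@le_trans _ _ (\sum_(n <= l < Q) 2 * tri_coef Q l)).
    apply: ler_sum => l _; rewrite normrM ger0_norm// mulrC ler_wpM2r//.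
    apply: le_trans (ler_normB _ _) _; rewrite normr1.
    have : `|wav Q l| <= 1 by exact: mean_wave_norm.
    by lra.
  by rewrite -mulr_sumr; have := @sum_tri_coef_tail R Q Q0 n n0; lra.
have head : `|\sum_(0 <= l < n) (tri_coef Q l * (1 - wav Q l) -
      d * (tri_coef Q l * (1 - expR (- (l.*2.+1%:R / n%:R)))))| <=
    (1 + 16 * (d + d ^+ 2)) / n%:R.
  apply: le_trans (ler_norm_sum _ _ _) _.
  apply: (@le_trans _ _ (\sum_(0 <= l < n) (tri_coef Q l / n%:R +
      16 * (d + d ^+ 2) / n%:R ^+ 2))).
    rewrite !big_nat; apply: ler_sum => l /= ln.
    have lQ : (l < Q)%N by exact: leq_trans nQ.
    set s := l.*2.+1%:R / n%:R.
    have s0 : 0 <= s by rewrite divr_ge0.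
    have kapE : kappa n (fun k => l.*2.+1%:Z * c k) = expR (- (s * d)).
      rewrite /kappa lattice_pointZ normrZ ger0_norm ?ler0z//.
      by congr (expR (- _)); rewrite /s mulrA [_^-1 * _]mulrC.
    rewrite (_ : _ - _ = tri_coef Q l * (expR (- (s * d)) - wav Q l) +
      tri_coef Q l * (1 - expR (- (s * d)) - d * (1 - expR (- s)))); last by ring.
    apply: le_trans (ler_normD _ _) _; rewrite !normrM (ger0_norm (tri0 l)).
    apply: lerD.
      apply: ler_wpM2l => //; rewrite -kapE.
      have wavl : forall l : 'I_n,
        `|kappa n (fun k => l.*2.+1%:Z * c k) - wav Q l| <= n%:R^-1 by near: Q.
      exact: (wavl (Ordinal ln)).
    apply: (@le_trans _ _ (tri_coef Q l * ((d + d ^+ 2) * s ^+ 2))).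
    + by apply: ler_wpM2l => //; exact: oneB_expRN_scale.
    + apply: (@le_trans _ _ (16 / l.*2.+1%:R ^+ 2 * ((d + d ^+ 2) * s ^+ 2))).
        rewrite ler_wpM2r ?tri_coef_le// mulr_ge0 ?sqr_ge0// addr_ge0// sqr_ge0//.
      rewrite le_eqVlt; apply/orP; left; apply/eqP; rewrite /s; field.
      by rewrite gt_eqF//= pnatr_eq0.
  rewrite big_split/= -mulr_suml sumr_const_nat subn0 [leRHS]mulrDl; apply: lerD.
    rewrite ler_wpM2r ?invr_ge0//.
    apply: (@le_trans _ _ (\sum_(0 <= l < Q) tri_coef Q l)).
      by rewrite [leRHS](big_cat_nat (n := n))//= lerDl sumr_ge0.
    by rewrite big_mkord sum_tri_coef//; lra.
  rewrite le_eqVlt; apply/orP; left; apply/eqP; rewrite -mulr_natr; field.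
  by rewrite gt_eqF.
by rewrite /err -/d; apply: le_trans (lerD head tail) _; rewrite -mulrDl; lra.
Unshelve. all: by end_near.
Qed.

(** The gain exceeds the errors O (1 / n) by a factor log n. *)
Let gain_ge Q n : (0 < n)%N -> (n <= Q)%N ->
  series harmonic n / (24 * n%:R) <= gain Q n.
Proof.
move=> n0 nQ; have n0R : 0 < n%:R :> R by rewrite ltr0n.
rewrite /series/= mulr_suml /gain !big_nat; apply: ler_sum => l /= ln.
have lQ : (l < Q)%N by exact: leq_trans nQ.
have Q0 : (0 < Q)%N by exact: leq_trans nQ.
have k0 : 0 < l.*2.+1%:R :> R by rewrite ltr0n.
set s := l.*2.+1%:R / n%:R.
have s0 : 0 <= s by rewrite divr_ge0// ltW.
have s2 : s <= 2 by rewrite ler_pdivrMr// -natrM ler_nat; lia.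
have se : s / 3 <= 1 - expR (- s).
  apply: le_trans (oneB_expRN_ge s0); rewrite ler_pdivlMr; last by lra.
  by nra.
apply: (@le_trans _ _ ((4 * l.*2.+1%:R ^+ 2)^-1 * (s / 3))); last first.
  have c0 : 0 <= (4 * l.*2.+1%:R ^+ 2 : R)^-1.
    by rewrite invr_ge0; apply: mulr_ge0 => //; exact: sqr_ge0.
  by apply: ler_pM c0 _ (tri_coef_ge Q0 lQ) se; rewrite divr_ge0.
rewrite (_ : (4 * _)^-1 * _ = (12 * n%:R * l.*2.+1%:R)^-1); last first.
  by rewrite /s; field; rewrite !gt_eqF.
have kl : l.*2.+1%:R <= 2 * l.+1%:R :> R by rewrite -natrM ler_nat; lia.
have l0 : 0 < l.+1%:R :> R by rewrite ltr0n.
rewrite -invfM lef_pV2 ?posrE ?mulr_gt0//.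
rewrite (_ : l.+1%:R * _ = 12 * n%:R * (2 * l.+1%:R)); last by ring.
by apply: ler_wpM2l kl; apply: mulr_ge0.
Qed.

(** Comparing the two sides of [qform_mean_tri_le] at scale 1 / n, the difference of
    the two sides of the claim is multiplied by the gain and the errors are
    O (1 / n): if the difference were positive, the harmonic series would be
    bounded. *)
Lemma parallelepiped_energy (I : finType) (a : I -> 'I_N -> int) (A : nat) (w : I -> R) :
  (forall i k, (`|a i k|%N <= A)%N) ->
  qform (fun i j => `|lattice_point (a i) - lattice_point (a j)|) w <=
  A%:R * (\sum_k `|g k|) * (\sum_i w i) ^+ 2.
Proof.
move=> aA; rewrite leNgt; apply/negP => lt.
set W := (\sum_i w i) ^+ 2 in lt *.
have W0 : 0 <= W by exact: sqr_ge0.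
pose delta (k : 'I_N) : 'I_N -> int := fun k' => (k' == k)%:R.
have deltaE k : lattice_point (delta k) = g k.
  rewrite /lattice_point (bigD1 k)//= /delta eqxx scale1r big1 ?addr0// => k' /negbTE->.
  by rewrite scale0r.
pose gapc i j k := a i k - a j k.
have gapE i j : lattice_point (gapc i j) = lattice_point (a i) - lattice_point (a j).
  exact: lattice_pointB.
set E := qform _ w in lt; set L := \sum_k _ in lt.
pose X := E - A%:R * L * W; have X0 : 0 < X by rewrite subr_gt0.
pose Cg := \sum_i \sum_j err (gapc i j).
pose K := Cg * (\sum_i `|w i|) ^+ 2 + A%:R * (\sum_k err (delta k)) * W.
have err0 c : 0 <= err c.
  by rewrite /err addr_ge0// mulr_ge0// addr_ge0// ?sqr_ge0.
have bound n : (0 < n)%N -> series harmonic n * X <= 24 * K.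
  move=> n0; have n0R : 0 < n%:R :> R by rewrite ltr0n.
  near \oo => Q.
  have Q0 : (0 < Q)%N by near: Q; exists 1%N.
  have nQ : (n <= Q)%N by near: Q; exists n.
  have egap i j : `|mean_tri Q (kappa n) (gapc i j) -
      `|lattice_point (gapc i j)| * gain Q n| <= Cg / n%:R.
    have : forall ij : I * I, `|mean_tri Q (kappa n) (gapc ij.1 ij.2) -
        `|lattice_point (gapc ij.1 ij.2)| * gain Q n| <= err (gapc ij.1 ij.2) / n%:R.
      by near: Q; apply: eventually_forall_fin => ij; exact: mean_tri_linear.
    move=> /(_ (i, j)) /le_trans; apply; rewrite ler_wpM2r ?invr_ge0//.
    rewrite /Cg (bigD1 i)//= (bigD1 j)//= -addrA lerDl.
    by rewrite addr_ge0// sumr_ge0// => i' _; rewrite sumr_ge0.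
  have edelta k : `|mean_tri Q (kappa n) (delta k) - `|g k| * gain Q n| <=
      err (delta k) / n%:R.
    have : forall k, `|mean_tri Q (kappa n) (delta k) -
        `|lattice_point (delta k)| * gain Q n| <= err (delta k) / n%:R.
      by near: Q; apply: eventually_forall_fin => k'; exact: mean_tri_linear.
    by move=> /(_ k); rewrite deltaE.
  have := qform_mean_tri_le Q0 (kappa_psd n) w aA.
  rewrite -/W -/delta => main.
  have low : gain Q n * E - Cg / n%:R * (\sum_i `|w i|) ^+ 2 <=
      qform (fun i j => mean_tri Q (kappa n) (gapc i j)) w.
    have := le_norm_qform w egap; rewrite ler_norml => /andP[+ _].
    rewrite qformB (@eq_qform _ _ (fun i j => `|lattice_point (gapc i j)| * gain Q n)
      (fun i j => gain Q n * `|lattice_point (a i) - lattice_point (a j)|)); last first.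
      by move=> i j; rewrite gapE mulrC.
    by rewrite qformZ -/E; lra.
  have up : A%:R * (\sum_k mean_tri Q (kappa n) (delta k)) * W <=
      A%:R * (L * gain Q n + (\sum_k err (delta k)) / n%:R) * W.
    rewrite ler_wpM2r// ler_wpM2l// /L !mulr_suml -big_split; apply: ler_sum => k _ /=.
    by have := edelta k; rewrite ler_norml => /andP[_]; lra.
  have gX : gain Q n * X <= K / n%:R.
    rewrite /X /K.
    have := le_trans low (le_trans main up).
    move: (gain Q n) (n%:R^-1) => ga ni; lra.
  have := ler_wpM2r (ltW X0) (gain_ge n0 nQ).
  move=> /le_trans /(_ gX); rewrite ler_pdivlMr// mulrAC -mulrA.
  rewrite (_ : (series harmonic n / (24 * n%:R)) * _ = series harmonic n * X / 24); first by lra.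
  by field; rewrite gt_eqF.
apply: (@dvg_harmonic R); apply: nondecreasing_is_cvgn.
  by apply: nondecreasing_series => k _ _; exact: harmonic_ge0.
exists (24 * K / X) => _ [n _ <-].
rewrite ler_pdivlMr//; case: n => [|n]; last exact: bound.
rewrite /series/= big_geq// mul0r; apply: mulr_ge0 => //.
have Cg0 : 0 <= Cg by apply: sumr_ge0 => i _; apply: sumr_ge0.
have D0 : 0 <= \sum_k err (delta k) by apply: sumr_ge0.
by rewrite addr_ge0// mulr_ge0// ?sqr_ge0// mulr_ge0.
Unshelve. all: by end_near.
Qed.

End ParallelepipedEnergy.

(** * The energy of weights in a ball *)

Section BallEnergy.
Context {R : realType} {V : normedModType R}.
Hypothesis ball_compact : compact [set x : V | `|x| <= 1].

Lemma half_net : exists N (y : 'I_N -> V),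
  forall x, `|x| <= 1 -> exists k, `|x - y k| <= 1 / 2.
Proof.
move: ball_compact; rewrite compact_cover.
move=> /(_ V setT (fun y => ball y (1 / 2))) [||D _ cov].
- by move=> y _; apply: ball_open; lra.
- by move=> x _; exists x => //; apply: ballxx; lra.
exists #|`D|, (fun k => tnth (in_tuple (enum_fset D)) k) => x x1.
have [y /= Dy yx] := cov x x1.
have /tnthP[k yk] : y \in in_tuple (enum_fset D) by [].
exists k; rewrite -yk; move: yx; rewrite -ball_normE/= distrC => /ltW; exact.
Qed.

(** Subtracting a nearby point of the net and doubling sends the ball to itself;
    iterating this produces the binary digits of the coefficients. *)
Lemma dyadic_approx N (y : 'I_N -> V) :
  (forall x, `|x| <= 1 -> exists k, `|x - y k| <= 1 / 2) ->
  forall m x, `|x| <= 1 -> exists a : 'I_N -> nat,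
    (forall k, (a k <= 2 ^ m.+1)%N) /\
    `|x - lattice_point (fun k => (2 ^+ m)^-1 *: y k) (fun k => (a k)%:Z)| <= (2 ^+ m)^-1.
Proof.
move=> net; elim=> [|m IH] x x1.
  exists (fun=> 0%N); split=> //.
  by rewrite /lattice_point big1 ?subr0 ?expr0 ?invr1// => k _; rewrite scale0r.
have [k xk] := net x x1.
have /IH[a [ale xa]] : `|2 *: (x - y k)| <= 1 by rewrite normrZ ger0_norm//; lra.
exists (fun j => (a j + (j == k) * 2 ^ m.+1)%N); split=> [j|].
  by rewrite [leqRHS]expnS mul2n -addnn leq_add//; case: (j == k); rewrite ?mul1n.
have two : (2 : R) != 0 by [].
have -> : x - lattice_point (fun k => (2 ^+ m.+1)^-1 *: y k)
    (fun j => (a j + (j == k) * 2 ^ m.+1)%N%:Z) =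
    2^-1 *: (2 *: (x - y k) - lattice_point (fun k => (2 ^+ m)^-1 *: y k) (fun k => (a k)%:Z)).
  rewrite scalerBr scalerA mulVf// scale1r -addrA -opprD; congr (x - _).
  rewrite /lattice_point scaler_sumr (bigD1 k)//= [in RHS](bigD1 k)//= addrA.
  congr (_ + _); last first.
    apply: eq_bigr => j /negbTE ->; rewrite mul0n addn0 !scalerA; congr (_ *: _).
    by rewrite exprS invfM; ring.
  rewrite eqxx mul1n !scalerA -[X in _ = X + _]scale1r -scalerDl; congr (_ *: _).
  rewrite -[_%:~R]/((a k + 2 ^ m.+1)%:R) -[_%:~R]/((a k)%:R) natrD natrX exprS.
  by field; rewrite expf_neq0.
rewrite normrZ ger0_norm ?invr_ge0// exprS invfM.
by rewrite ler_wpM2l// invr_ge0.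
Qed.

Hypothesis expdist_psd : forall (J : finType) (x : J -> V),
  psd (fun i j => expR (- `|x i - x j|)).

(** A finite net of the ball generates a sequence of parallelepipeds that
    approximate all the points of the ball and whose edges have a fixed sum. *)
Lemma ball_energy : exists2 C : R, 0 <= C &
  forall (I : finType) (x : I -> V) (w : I -> R), (forall i, `|x i| <= 1) ->
    qform (fun i j => `|x i - x j|) w <= C * (\sum_i w i) ^+ 2.
Proof.
have [N [y net]] := half_net.
exists (2 * \sum_k `|y k|); first by rewrite mulr_ge0// sumr_ge0.
move=> I x w x1; apply/ler_addgt0Pr => e e0.
set S := (\sum_i `|w i|) ^+ 2; have S0 : 0 <= S by exact: sqr_ge0.
pose m := Num.bound (2 * S / e).
have m2 : 2 * (2 ^+ m)^-1 * S <= e.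
  have Sm : 2 * S / e < m%:R.
    by apply: archi_boundP; apply: divr_ge0; [exact: mulr_ge0|exact: ltW].
  have : m%:R <= 2 ^+ m :> R by rewrite -natrX ler_nat ltnW// ltn_expl.
  move: Sm; rewrite ltr_pdivrMr// mulrAC ler_pdivrMr ?exprn_gt0//.
  by move: (2 ^+ m : R) (m%:R : R) => p q; nra.
pose g k := (2 ^+ m)^-1 *: y k.
have /choice[a ha] : forall i, exists a : 'I_N -> nat, (forall k, (a k <= 2 ^ m.+1)%N) /\
    `|x i - lattice_point g (fun k => (a k)%:Z)| <= (2 ^+ m)^-1.
  by move=> i; exact: (dyadic_approx net m (x1 i)).
pose z i := lattice_point g (fun k => (a i k)%:Z).
have zle : qform (fun i j => `|z i - z j|) w <= 2 * (\sum_k `|y k|) * (\sum_i w i) ^+ 2.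
  have := @parallelepiped_energy _ _ expdist_psd _ g _
    (fun i k => (a i k)%:Z) (2 ^ m.+1) w (fun i k => (ha i).1 k).
  suff -> : (2 ^ m.+1)%:R * \sum_k `|g k| = 2 * \sum_k `|y k| by [].
  rewrite !mulr_sumr; apply: eq_bigr => k _.
  rewrite normrZ ger0_norm ?invr_ge0// natrX exprS.
  by field; rewrite expf_neq0.
have err i j : `| `|x i - x j| - `|z i - z j| | <= 2 * (2 ^+ m)^-1.
  apply: le_trans (ler_dist_dist _ _) _.
  rewrite (_ : _ - _ = (x i - z i) - (x j - z j)); last first.
    by rewrite !opprD !opprK addrACA.
  apply: le_trans (ler_normB _ _) _.
  by have := (ha i).2; have := (ha j).2; rewrite -/(z i) -/(z j); lra.
have := le_norm_qform w err; rewrite qformB -/S ler_norml => /andP[_].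
by lra.
Qed.

End BallEnergy.

(** * Magnitude *)

Section Magnitude.
Context {R : realType} {M : metricType R}.
Hypothesis M_pd : positive_definite M.
Implicit Types F : {fset M}.

Let qform_mx n (A : 'M[R]_n) (v : 'cV[R]_n) :
  (v^T *m A *m v) 0 0 = qform (fun i j => A i j) (fun i => v i 0).
Proof.
rewrite mxE; under eq_bigr do rewrite mxE mulr_suml.
rewrite exchange_big; apply: eq_bigr => i _; apply: eq_bigr => j _ /=.
by rewrite !mxE mulrAC.
Qed.

(** Points that coincide are merged, and their weights added, before the similarity
    matrix of a finite set is used. *)
Lemma expdist_psd (J : finType) (x : J -> M) :
  psd (fun i j => expR (- mdist (x i) (x j))).
Proof.
move=> w; pose F : {fset M} := [fset y in codom x]%fset.
have xF i : x i \in in_tuple (enum_fset F) by rewrite inE/= codom_f.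
have /choice[f fE] : forall i, exists p, @fset_point _ _ F p = x i.
  by move=> i; have /tnthP[p xp] := xF i; exists p.
rewrite (@eq_qform _ _ _ (fun i j => similarity_mx F (f i) (f j))); last first.
  by move=> i j; rewrite mxE !fE.
rewrite (qform_push f (fun i j => similarity_mx F i j)).
pose u : 'cV[R]_#|`F| := \col_p \sum_(i | f i == p) w i.
rewrite [leRHS](_ : _ = (u^T *m similarity_mx F *m u) 0 0); last first.
  rewrite qform_mx; apply: eq_bigr => i _; apply: eq_bigr => j _.
  by rewrite /u !mxE.
have [->|u0] := eqVneq u 0; first by rewrite mulmx0 mxE.
exact/ltW/(M_pd F).2.
Qed.

Let similarity_unit F : similarity_mx F \in unitmx.
Proof.
rewrite unitmxE unitfE; apply/negP => /det0P[v v0 vZ].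
have := (M_pd F).2 v^T; rewrite trmxK vZ mul0mx mxE ltxx => /(_ _)/negP; apply=> //.
by apply: contra v0 => /eqP /(congr1 trmx); rewrite trmxK trmx0 => ->.
Qed.

(** The row sums of the inverse of the similarity matrix, which sum up to the
    magnitude. *)
Let weighting F : 'cV[R]_#|`F| := invmx (similarity_mx F) *m const_mx 1.

Let sum_weighting F : \sum_i weighting F i 0 = fset_mag F.
Proof.
apply: eq_bigr => i _; rewrite mxE; apply: eq_bigr => j _.
by rewrite [const_mx _ _ _]mxE mulr1.
Qed.

Let similarity_weighting F i :
  \sum_j similarity_mx F i j * weighting F j 0 = 1.
Proof.
have := mulKVmx (similarity_unit F) (const_mx 1 : 'cV[R]_#|`F|).
by move=> /matrixP/(_ i 0); rewrite mxE [RHS]mxE.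
Qed.

(** The square of the sum of the weights is compared with the form at the
    weighting, where both are given by the magnitude. *)
Lemma fset_mag_le F (c : R) : 0 <= c ->
  (forall w, (\sum_i w i) ^+ 2 <=
     c * qform (fun i j => expR (- mdist (@fset_point _ _ F i) (fset_point j))) w) ->
  fset_mag F <= c.
Proof.
move=> c0 /(_ (fun i => weighting F i 0)).
have -> : qform (fun i j => expR (- mdist (@fset_point _ _ F i) (fset_point j)))
    (fun i => weighting F i 0) = fset_mag F.
  rewrite -sum_weighting; apply: eq_bigr => i _.
  rewrite -[RHS]mulr1 -(similarity_weighting i) mulr_sumr; apply: eq_bigr => j _.
  by rewrite [similarity_mx _ _ _]mxE; ring.
rewrite sum_weighting expr2.
have [mag0 _|mag0] := leP (fset_mag F) 0; first exact: le_trans c0.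
by rewrite ler_pM2r.
Qed.

Lemma fset_mag1 (x : M) : fset_mag [fset x]%fset = 1.
Proof.
have card1 : (0 < #|` [fset x]%fset|)%N by rewrite cardfs1.
have point y : @fset_point _ _ [fset x]%fset y = x.
  have : fset_point y \in [fset x]%fset by exact: mem_tnth.
  by rewrite inE => /eqP.
rewrite -sum_weighting -(similarity_weighting (Ordinal card1)).
by apply: eq_bigr => j _; rewrite [similarity_mx _ _ _]mxE !point mdistxx oppr0 expR0 mul1r.
Qed.

Lemma mag_ge1 (K : set M) x : K x -> (1%:E <= mag K)%E.
Proof.
move=> Kx; rewrite -(fset_mag1 x); apply: ereal_sup_ubound.
by exists [fset x]%fset => // y /=; rewrite inE => /eqP->.
Qed.

End Magnitude.

(** * Continuity at singletons *)

Section SmallBalls.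
Context {R : realType} {V : normedModType R}.
Hypothesis V_tractable : tractable (norm_metric V).

(** On a ball of radius r the kernel C * r - d is positive semidefinite, hence
    its exponential dominates the constant kernel 1. *)
Lemma mag_small_ball : exists2 C : R, 0 <= C &
  forall (x : norm_metric V) (r : R) (K : set (norm_metric V)), 0 < r ->
    K `<=` mclosed_ball x r -> (mag K <= (expR (C * r))%:E)%E.
Proof.
have [V_pd V_ball] := V_tractable.
have ball_compact : compact [set x : V | `|x| <= 1].
  have -> : [set x : V | `|x| <= 1] = @mclosed_ball _ (norm_metric V) (0 : V) 1.
    by apply/seteqP; split=> x; rewrite /mclosed_ball/= /mdist/= sub0r normrN.
  exact: (V_ball _ _ ltr01).1.
have [C C0 energy] := ball_energy ball_compact (@expdist_psd _ _ V_pd).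
exists C => // x r K r0 Kr; apply: ub_ereal_sup => _ [F FK <-]; rewrite lee_fin.
apply: (fset_mag_le V_pd); first exact: expR_ge0.
move=> w; set p := @fset_point _ _ F.
have pr i : `|(p i : V) - x| <= r.
  have : mclosed_ball x r (p i) by apply/Kr/FK; exact: mem_tnth.
  by rewrite /mclosed_ball/= /mdist/= distrC.
pose z i : V := r^-1 *: ((p i : V) - x).
have z1 i : `|z i| <= 1.
  rewrite normrZ ger0_norm; last by rewrite invr_ge0 ltW.
  by rewrite mulrC ler_pdivrMr// mul1r.
have pz i j : mdist (p i) (p j) = r * `|z i - z j|.
  rewrite -scalerBr opprB addrA subrK normrZ ger0_norm; last by rewrite invr_ge0 ltW.
  by rewrite mulrA divff ?gt_eqF// mul1r.
have := @qform_expR_ge _ _ (fun i j => C * r - mdist (p i) (p j)) w.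
rewrite -qformZ => /(_ _ _)/le_trans; apply.
- by move=> i j; rewrite metric_sym.
- move=> v; rewrite qformB qform_const (eq_qform v pz) qformZ.
  rewrite [C * r]mulrC -mulrA -mulrBr; apply: mulr_ge0; first exact: ltW.
  by rewrite subr_ge0 energy.
by rewrite le_eqVlt; apply/orP; left; apply/eqP; apply: eq_qform => i j; rewrite expRD.
Qed.

End SmallBalls.

Theorem corollary3p11 (R : realType) (V : normedModType R)
    (hV : tractable (norm_metric V)) (x : norm_metric V) :
  {for cmp_singleton x, continuous (@mag_cmp R (norm_metric V))}.
Proof.
have [C C0 small] := mag_small_ball hV.
move=> U /nbhs_ballP[e /= e0 eU].
pose r := ln (1 + e / 2) / (C + 1).
have ln0 : 0 < ln (1 + e / 2) by rewrite ln_gt0//; lra.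
have r0 : 0 < r by rewrite divr_gt0//; lra.
have eCr : expR (C * r) <= 1 + e / 2.
  rewrite -[leRHS]lnK ?posrE; last by lra.
  rewrite ler_expR /r mulrCA -[leRHS]mulr1 ler_pM2l// ler_pdivrMr; lra.
have bounds (K : cmp_plus (norm_metric V)) : cmp_set K `<=` mclosed_ball x r ->
    1 <= mag_cmp K <= 1 + e / 2.
  move=> Kr; have [y Ky] := cmp_neq0 K.
  have := small x r K r0 Kr; have := mag_ge1 hV.1 Ky.
  by rewrite -(mag_cmp_EFin K hV) !lee_fin => -> /le_trans; exact.
change (nbhs (cmp_singleton x) (@mag_cmp R (norm_metric V) @^-1` U)).
apply/nbhs_ballP; exists r => // K; rewrite /= ballEmdist/= => Kr.
apply: eU; rewrite -ball_normE/=.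
have /bounds : cmp_set K `<=` mclosed_ball x r.
  move=> y Ky; rewrite /mclosed_ball/=.
  have : set_dist y (cmp_singleton x) < r.
    apply: le_lt_trans (set_dist_excess _ Ky) _; apply: le_lt_trans Kr.
    by rewrite le_max lexx orbT.
  by move=> /(@set_dist_lt _ _ _ (cmp_singleton x))[_ -> yx]; rewrite metric_sym ltW.
have /bounds : cmp_set (cmp_singleton x) `<=` mclosed_ball x r.
  by move=> _ ->; rewrite /mclosed_ball/= mdistxx ltW.
by move=> /andP[h1 h2] /andP[h3 h4]; rewrite ltr_norml; apply/andP; split; lra.
Qed.
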